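(* Let $\mathbf{B}$ be a cartesian bicategory in which every map is comonadic. Then every object of $\mathbf{B}$ is Frobenius. (That is, for a cartesian bicategory, the axiom ''Maps are Comonadic'' implies the axiom ''Frobenius''.)
   Context: Bicategories are taken normal (identity constraints strict). A map in a bicategory $\mathbf{B}$ is an arrow $f$ having a right adjoint; a chosen right adjoint is written $f^*$, with unit $\eta_f:1\to f^*f$ and counit $\epsilon_f:ff^*\to 1$. $\mathrm{Map}\,\mathbf{B}$ is the locally full subbicategory of $\mathbf{B}$ with the same objects, the maps as arrows, and all 2-cells between them. Limits in bicategories are meant in the bicategorical sense. Cartesian bicategory: $\mathbf{B}$ is cartesian if (1) $\mathrm{Map}\,\mathbf{B}$ has finite products $\times$, $1$, with projections $p,r$; (2) each hom category $\mathbf{B}(X,A)$ has finite products, written $\wedge,\top$; (3) the following canonical lax functors $\otimes:\mathbf{B}\times\mathbf{B}\to\mathbf{B}$ and $I:\mathbf{1}\to\mathbf{B}$ are pseudofunctors (their constraints are invertible). On objects $X\otimes Y=X\times Y$; for arrows $R:X\to A$, $S:Y\to B$, $R\otimes S=(p_{A,B}^*\,R\,p_{X,Y})\wedge(r_{A,B}^*\,S\,r_{X,Y})$; the constraint $1_{X\otimes Y}\to 1_X\otimes 1_Y$ is induced by the units $\eta_p,\eta_r$, and $(R'\otimes S')(R\otimes S)\to (R'R)\otimes(S'S)$ is induced by the local projections and the counits $\epsilon_p,\epsilon_r$. $I$ picks the object $I=1$ with the arrow $\top_{I,I}$, with constraints the unique 2-cells $1_I\to\top_{I,I}$ and $\top_{I,I}\top_{I,I}\to\top_{I,I}$.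 The map $d=d_A:A\to A\otimes A$ is the diagonal, and $a:(A\otimes A)\otimes A\to A\otimes(A\otimes A)$ is the associativity equivalence. An object $A$ is Frobenius if the 2-cell $d\,d^*\to(1\otimes d^* )\,a\,(d\otimes 1)$, the mate of the canonical isomorphism $(1\otimes d)d\cong a(d\otimes 1)d$ under $d\dashv d^*$ and $1\otimes d\dashv 1\otimes d^*$, is invertible (Beck condition). An Eilenberg-Moore object for a comonad $(A,G,\epsilon,\delta)$ in $\mathbf{B}$ is an object $A_G$ with an arrow $g:A_G\to A$ and a counital, coassociative coaction $\gamma:g\to Gg$ such that for every $X$ composition with $(g,\gamma)$ is an equivalence from $\mathbf{B}(X,A_G)$ to the category of $G$-coalgebras with domain $X$. A map $g:X\to A$ is comonadic if $X$ with $g$ and $g\eta_g:g\to gg^*g$ is an Eilenberg-Moore object for the comonad $gg^*$ on $A$. *)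

(* Defs.v *)
From mathcomp Require Import ssreflect ssrfun.
From Stdlib Require Import ProofIrrelevance.

Set Implicit Arguments.
Unset Strict Implicit.
Unset Printing Implicit Defensive.

Declare Scope bicat_scope.
Delimit Scope bicat_scope with bicat.
Open Scope bicat_scope.

Record category := Category {
  ob :> Type;
  hom : ob -> ob -> Type;
  idc : forall x, hom x x;
  compc : forall x y z, hom y z -> hom x y -> hom x z;
  comp1c : forall x y (f : hom x y), compc (idc y) f = f;
  compc1 : forall x y (f : hom x y), compc f (idc x) = f;
  compcA : forall x y z w (h : hom z w) (g : hom y z) (f : hom x y),
    compc (compc h g) f = compc h (compc g f) }.

Arguments hom {c} x y.
Arguments idc {c} x.
Arguments compc {c x y z} g f.
Arguments comp1c {c x y} f.
Arguments compc1 {c x y} f.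
Arguments compcA {c x y z w} h g f.

Notation "g • f" := (compc g f) (at level 51, right associativity) : bicat_scope.
Notation "x ⇒ y" := (hom x y) (at level 70, no associativity) : bicat_scope.

Record is_iso (C : category) (x y : C) (f : x ⇒ y) := IsIso {
  inv : y ⇒ x;
  inv_l : inv • f = idc x;
  inv_r : f • inv = idc y }.

Arguments inv {C x y f} i.
Arguments inv_l {C x y f} i.
Arguments inv_r {C x y f} i.

Definition invertible (C : category) (x y : C) (f : x ⇒ y) : Prop :=
  inhabited (is_iso f).

Record iso (C : category) (x y : C) := Iso {
  fwd :> x ⇒ y;
  iso_is_iso : is_iso fwd }.

Arguments iso {C} x y.
Arguments fwd {C x y} i.

Notation "x ≅ y" := (iso x y) (at level 70, no associativity) : bicat_scope.

Definition bwd (C : category) (x y : C) (f : x ≅ y) : y ⇒ x := inv (iso_is_iso f).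

Record functor (C D : category) := Functor {
  fobj :> C -> D;
  fmap : forall x y : C, x ⇒ y -> fobj x ⇒ fobj y;
  fmap1 : forall x, fmap (idc x) = idc (fobj x);
  fmapM : forall x y z (g : y ⇒ z) (f : x ⇒ y), fmap (g • f) = fmap g • fmap f }.

Arguments fmap {C D} F {x y} f : rename.

(* Equivalence of categories: essentially surjective (with chosen lifts) and
   fully faithful (with the inverse bijection on hom-sets as data). *)
Record equivalence (C D : category) (F : functor C D) := Equivalence {
  lift_ob : D -> C;
  lift_iso : forall y : D, F (lift_ob y) ≅ y;
  lift_hom : forall x x' : C, F x ⇒ F x' -> x ⇒ x';
  fmap_lift : forall x x' (h : F x ⇒ F x'), fmap F (lift_hom h) = h;
  lift_fmap : forall (x x' : C) (f : x ⇒ x'), lift_hom (fmap F f) = f }.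

Section Categories.
Implicit Types C D : category.

Definition id_iso C (x : C) : x ≅ x :=
  Iso (IsIso (comp1c (idc x)) (comp1c (idc x))).

Definition inv_iso C (x y : C) (f : x ≅ y) : y ≅ x :=
  Iso (IsIso (inv_r (iso_is_iso f)) (inv_l (iso_is_iso f))).

Lemma bwdK C (x y : C) (f : x ≅ y) : bwd f • f = idc x.
Proof. exact: inv_l. Qed.

Lemma fwdK C (x y : C) (f : x ≅ y) : f • bwd f = idc y.
Proof. exact: inv_r. Qed.

Lemma bwdKA C (x y z : C) (f : x ≅ y) (g : z ⇒ x) : bwd f • f • g = g.
Proof. by rewrite -compcA bwdK comp1c. Qed.

Lemma fwdKA C (x y z : C) (f : x ≅ y) (g : z ⇒ y) : f • bwd f • g = g.
Proof. by rewrite -compcA fwdK comp1c. Qed.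

Lemma iso_monic C (x y z : C) (f : x ≅ y) (g h : z ⇒ x) : f • g = f • h -> g = h.
Proof. by move=> e; rewrite -(bwdKA f g) e bwdKA. Qed.

Lemma iso_epic C (x y z : C) (f : x ≅ y) (g h : y ⇒ z) : g • f = h • f -> g = h.
Proof. by move=> e; rewrite -(compc1 g) -(compc1 h) -(fwdK f) -!compcA e. Qed.

Lemma comp_eqA C (x y z w : C) (g : y ⇒ z) (f : x ⇒ y) (k : x ⇒ z) :
  g • f = k -> forall h : w ⇒ x, g • f • h = k • h.
Proof. by move=> <- h; rewrite compcA. Qed.

Lemma bwd_nat C (x y x' y' : C) (f : x ≅ y) (f' : x' ≅ y') (a : x ⇒ x') (b : y ⇒ y') :
  f' • a = b • f -> bwd f' • b = a • bwd f.
Proof.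
by move=> e; apply: (iso_monic (f := f')); rewrite fwdKA -compcA e compcA fwdK compc1.
Qed.

Fact comp_iso_l C (x y z : C) (g : y ≅ z) (f : x ≅ y) :
  (bwd f • bwd g) • (g • f) = idc x.
Proof. by rewrite !compcA bwdKA bwdK. Qed.

Fact comp_iso_r C (x y z : C) (g : y ≅ z) (f : x ≅ y) :
  (g • f) • (bwd f • bwd g) = idc z.
Proof. by rewrite !compcA fwdKA fwdK. Qed.

Definition comp_iso C (x y z : C) (g : y ≅ z) (f : x ≅ y) : x ≅ z :=
  Iso (IsIso (comp_iso_l g f) (comp_iso_r g f)).

Definition prod_cat C D : category := {|
  ob := C * D;
  hom := fun x y => ((fst x ⇒ fst y) * (snd x ⇒ snd y))%type;
  idc := fun x => (idc (fst x), idc (snd x));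
  compc := fun x y z g f => (fst g • fst f, snd g • snd f);
  comp1c := fun x y f =>
    etrans (f_equal2 pair (comp1c _) (comp1c _)) (esym (surjective_pairing f));
  compc1 := fun x y f =>
    etrans (f_equal2 pair (compc1 _) (compc1 _)) (esym (surjective_pairing f));
  compcA := fun x y z w h g f => f_equal2 pair (compcA _ _ _) (compcA _ _ _) |}.

Fact prod_iso_l C D (x y : prod_cat C D) (f : x ≅ y) :
  ((fst (bwd f) • fst (fwd f) = idc (fst x)) * (fst (fwd f) • fst (bwd f) = idc (fst y))).
Proof. by split; [have := bwdK f | have := fwdK f] => /= -[]. Qed.

Fact prod_iso_r C D (x y : prod_cat C D) (f : x ≅ y) :
  ((snd (bwd f) • snd (fwd f) = idc (snd x)) * (snd (fwd f) • snd (bwd f) = idc (snd y))).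
Proof. by split; [have := bwdK f | have := fwdK f] => /= -[]. Qed.

Definition fst_iso C D (x y : prod_cat C D) (f : x ≅ y) : fst x ≅ fst y :=
  Iso (IsIso (fst (prod_iso_l f)) (snd (prod_iso_l f))).

Definition snd_iso C D (x y : prod_cat C D) (f : x ≅ y) : snd x ≅ snd y :=
  Iso (IsIso (fst (prod_iso_r f)) (snd (prod_iso_r f))).

Definition pair_iso C D (x y : prod_cat C D) (f : fst x ≅ fst y)
    (g : snd x ≅ snd y) : x ≅ y :=
  @Iso (prod_cat C D) x y (fwd f, fwd g)
    (@IsIso (prod_cat C D) x y (fwd f, fwd g) (bwd f, bwd g)
      (f_equal2 pair (bwdK f) (bwdK g)) (f_equal2 pair (fwdK f) (fwdK g))).

Section ReflectIso.
Variables (C D : category) (F : functor C D) (E : equivalence F).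
Variables (x y : C) (h : F x ≅ F y).

Fact reflect_iso_l : lift_hom E (bwd h) • lift_hom E h = idc x.
Proof. by rewrite -[LHS](lift_fmap E) fmapM !fmap_lift bwdK -fmap1 lift_fmap. Qed.

Fact reflect_iso_r : lift_hom E h • lift_hom E (bwd h) = idc y.
Proof. by rewrite -[LHS](lift_fmap E) fmapM !fmap_lift fwdK -fmap1 lift_fmap. Qed.

Definition reflect_iso : x ≅ y := Iso (IsIso reflect_iso_l reflect_iso_r).

End ReflectIso.

Definition unit_cat : category := {|
  ob := unit;
  hom := fun _ _ => unit;
  idc := fun _ => tt;
  compc := fun _ _ _ _ _ => tt;
  comp1c := fun _ _ f => match f with tt => erefl end;
  compc1 := fun _ _ f => match f with tt => erefl end;
  compcA := fun _ _ _ _ _ _ _ => erefl |}.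

Definition to_unit_cat C : functor C unit_cat := {|
  fobj := fun _ => (tt : unit_cat);
  fmap := fun _ _ _ => tt;
  fmap1 := fun _ => erefl;
  fmapM := fun _ _ _ _ _ => erefl |}.

Definition full_subcat C (P : C -> Prop) : category := {|
  ob := sig P;
  hom := fun x y => proj1_sig x ⇒ proj1_sig y;
  idc := fun x => idc (proj1_sig x);
  compc := fun x y z g f => g • f;
  comp1c := fun x y f => comp1c f;
  compc1 := fun x y f => compc1 f;
  compcA := fun x y z w h g f => compcA h g f |}.

Definition subcat_iso C (P : C -> Prop) (x y : full_subcat P)
    (f : proj1_sig x ≅ proj1_sig y) : x ≅ y :=
  @Iso (full_subcat P) x y f (@IsIso (full_subcat P) x y f (bwd f) (bwdK f) (fwdK f)).

Record cat_products C := CatProducts {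
  top : C;
  bang : forall x : C, x ⇒ top;
  bang_uniq : forall (x : C) (f : x ⇒ top), f = bang x;
  meet : C -> C -> C;
  fstc : forall x y : C, meet x y ⇒ x;
  sndc : forall x y : C, meet x y ⇒ y;
  pairc : forall z x y : C, z ⇒ x -> z ⇒ y -> z ⇒ meet x y;
  fst_pairc : forall z x y (f : z ⇒ x) (g : z ⇒ y), fstc x y • pairc f g = f;
  snd_pairc : forall z x y (f : z ⇒ x) (g : z ⇒ y), sndc x y • pairc f g = g;
  pairc_uniq : forall z x y (h : z ⇒ meet x y),
    h = pairc (fstc x y • h) (sndc x y • h) }.

End Categories.

Arguments subcat_iso {C P} x y f.
Arguments pair_iso {C D} x y f g.
Arguments top {C} c.
Arguments bang {C} c x.
Arguments meet {C} c x y.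
Arguments fstc {C} c x y.
Arguments sndc {C} c x y.
Arguments pairc {C} c {z x y} f g.

(* The composition g ∘ f is in the applicative order; α ⋆ β is the horizontal
   composite of 2-cells, with the same convention. *)
Record bicategory := Bicategory {
  ob1 :> Type;
  hom1 : ob1 -> ob1 -> category;
  id1 : forall X, hom1 X X;
  comp1 : forall X Y Z, hom1 Y Z -> hom1 X Y -> hom1 X Z;
  comp2 : forall X Y Z (g g' : hom1 Y Z) (f f' : hom1 X Y),
    g ⇒ g' -> f ⇒ f' -> comp1 g f ⇒ comp1 g' f';
  comp2_id : forall X Y Z (g : hom1 Y Z) (f : hom1 X Y),
    comp2 (idc g) (idc f) = idc (comp1 g f);
  interchange : forall X Y Z (g g' g'' : hom1 Y Z) (f f' f'' : hom1 X Y)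
    (b' : g' ⇒ g'') (b : g ⇒ g') (a' : f' ⇒ f'') (a : f ⇒ f'),
    comp2 (b' • b) (a' • a) = comp2 b' a' • comp2 b a;
  assoc : forall X Y Z W (h : hom1 Z W) (g : hom1 Y Z) (f : hom1 X Y),
    comp1 (comp1 h g) f ≅ comp1 h (comp1 g f);
  assoc_nat : forall X Y Z W (h h' : hom1 Z W) (g g' : hom1 Y Z) (f f' : hom1 X Y)
    (c : h ⇒ h') (b : g ⇒ g') (a : f ⇒ f'),
    assoc h' g' f' • comp2 (comp2 c b) a = comp2 c (comp2 b a) • assoc h g f;
  lunit : forall X Y (f : hom1 X Y), comp1 (id1 Y) f ≅ f;
  lunit_nat : forall X Y (f f' : hom1 X Y) (a : f ⇒ f'),
    lunit f' • comp2 (idc (id1 Y)) a = a • lunit f;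
  runit : forall X Y (f : hom1 X Y), comp1 f (id1 X) ≅ f;
  runit_nat : forall X Y (f f' : hom1 X Y) (a : f ⇒ f'),
    runit f' • comp2 a (idc (id1 X)) = a • runit f;
  pentagon : forall X Y Z W V
    (k : hom1 W V) (h : hom1 Z W) (g : hom1 Y Z) (f : hom1 X Y),
    assoc k h (comp1 g f) • assoc (comp1 k h) g f =
    comp2 (idc k) (assoc h g f) • assoc k (comp1 h g) f
      • comp2 (assoc k h g) (idc f);
  triangle : forall X Y Z (g : hom1 Y Z) (f : hom1 X Y),
    comp2 (idc g) (lunit f) • assoc g (id1 Y) f = comp2 (runit g) (idc f) }.

Arguments hom1 {_} X Y.
Arguments id1 {_} X.
Arguments comp1 {_ X Y Z} g f.
Arguments comp2 {_ X Y Z g g' f f'} _ _.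
Arguments assoc {_ X Y Z W} h g f.
Arguments lunit {_ X Y} f.
Arguments runit {_ X Y} f.

Notation "X ⟶ Y" := (hom1 X Y) (at level 75, no associativity) : bicat_scope.
Notation "g ∘ f" := (comp1 g f) (at level 40, left associativity) : bicat_scope.
Notation "β ⋆ α" := (comp2 β α) (at level 42, left associativity) : bicat_scope.
Notation "f ◁ α" := (comp2 (idc f) α) (at level 42, left associativity) : bicat_scope.
Notation "α ▷ f" := (comp2 α (idc f)) (at level 42, left associativity) : bicat_scope.
Notation "'𝟙' X" := (id1 X) (at level 9, X at level 8) : bicat_scope.

Definition eq_to_hom (C : category) (x y : C) (e : x = y) : x ⇒ y :=
  match e in _ = z return x ⇒ z with erefl => idc x end.

(* The unit constraints are identities, transported along 1 f = f and f 1 = f. *)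
Definition normal (B : bicategory) : Prop :=
  (forall (X Y : B) (f : X ⟶ Y),
     exists e : 𝟙 Y ∘ f = f, fwd (lunit f) = eq_to_hom e) /\
  (forall (X Y : B) (f : X ⟶ Y),
     exists e : f ∘ 𝟙 X = f, fwd (runit f) = eq_to_hom e).

Section Bicategories.
Variable B : bicategory.
Implicit Types X Y Z W : B.

Section Whisker.
Variables X Y Z : B.
Implicit Types (f : X ⟶ Y) (g : Y ⟶ Z).

Lemma whiskerlM g f f' f'' (a' : f' ⇒ f'') (a : f ⇒ f') :
  g ◁ (a' • a) = (g ◁ a') • (g ◁ a).
Proof. by rewrite -interchange comp1c. Qed.

Lemma whiskerrM g g' g'' f (b' : g' ⇒ g'') (b : g ⇒ g') :
  (b' • b) ▷ f = (b' ▷ f) • (b ▷ f).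
Proof. by rewrite -interchange comp1c. Qed.

Lemma whisker_lr g g' f f' (b : g ⇒ g') (a : f ⇒ f') :
  (g' ◁ a) • (b ▷ f) = b ⋆ a.
Proof. by rewrite -interchange comp1c compc1. Qed.

Lemma whisker_rl g g' f f' (b : g ⇒ g') (a : f ⇒ f') :
  (b ▷ f') • (g ◁ a) = b ⋆ a.
Proof. by rewrite -interchange comp1c compc1. Qed.

Lemma exchange g g' f f' (b : g ⇒ g') (a : f ⇒ f') :
  (b ▷ f') • (g ◁ a) = (g' ◁ a) • (b ▷ f).
Proof. by rewrite whisker_lr whisker_rl. Qed.

Fact whiskerl_iso_l g f f' (a : f ≅ f') : (g ◁ bwd a) • (g ◁ a) = idc (g ∘ f).
Proof. by rewrite -whiskerlM bwdK comp2_id. Qed.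

Fact whiskerl_iso_r g f f' (a : f ≅ f') : (g ◁ a) • (g ◁ bwd a) = idc (g ∘ f').
Proof. by rewrite -whiskerlM fwdK comp2_id. Qed.

Definition whiskerl_iso g f f' (a : f ≅ f') : g ∘ f ≅ g ∘ f' :=
  Iso (IsIso (whiskerl_iso_l g a) (whiskerl_iso_r g a)).

Fact whiskerr_iso_l g g' f (b : g ≅ g') : (bwd b ▷ f) • (b ▷ f) = idc (g ∘ f).
Proof. by rewrite -whiskerrM bwdK comp2_id. Qed.

Fact whiskerr_iso_r g g' f (b : g ≅ g') : (b ▷ f) • (bwd b ▷ f) = idc (g' ∘ f).
Proof. by rewrite -whiskerrM fwdK comp2_id. Qed.

Definition whiskerr_iso g g' f (b : g ≅ g') : g ∘ f ≅ g' ∘ f :=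
  Iso (IsIso (whiskerr_iso_l f b) (whiskerr_iso_r f b)).

End Whisker.


Section Coherence.
Variables (X Y Z W : B) (h : Z ⟶ W) (g : Y ⟶ Z) (f : X ⟶ Y).

Lemma assoc_l f' (a : f ⇒ f') :
  assoc h g f' • (h ∘ g ◁ a) = (h ◁ (g ◁ a)) • assoc h g f.
Proof. by rewrite -assoc_nat comp2_id. Qed.

Lemma assoc_m g' (b : g ⇒ g') :
  assoc h g' f • ((h ◁ b) ▷ f) = (h ◁ (b ▷ f)) • assoc h g f.
Proof. by rewrite -assoc_nat. Qed.

Lemma assoc_r h' (c : h ⇒ h') :
  assoc h' g f • ((c ▷ g) ▷ f) = (c ▷ (g ∘ f)) • assoc h g f.
Proof. by rewrite assoc_nat comp2_id. Qed.

End Coherence.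

Lemma id_whiskerl_inj X Y (f f' : X ⟶ Y) (a b : f ⇒ f') :
  𝟙 Y ◁ a = 𝟙 Y ◁ b -> a = b.
Proof. by move=> e; apply: (iso_epic (f := lunit f)); rewrite -!lunit_nat e. Qed.

Lemma id_whiskerr_inj X Y (f f' : X ⟶ Y) (a b : f ⇒ f') :
  a ▷ 𝟙 X = b ▷ 𝟙 X -> a = b.
Proof. by move=> e; apply: (iso_epic (f := runit f)); rewrite -!runit_nat e. Qed.

Lemma lunit_comp X Y Z (g : Y ⟶ Z) (f : X ⟶ Y) :
  lunit (g ∘ f) • assoc (𝟙 Z) g f = lunit g ▷ f.
Proof.
apply: id_whiskerl_inj; rewrite whiskerlM.
apply: (iso_epic (f := assoc _ _ _)).
apply: (iso_epic (f := whiskerr_iso f (assoc _ _ _))) => /=.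
rewrite !compcA -pentagon (comp_eqA (triangle _ _)) -assoc_r.
by rewrite (comp_eqA (esym (assoc_m _ _ _))) compcA -whiskerrM triangle.
Qed.

Lemma runit_comp X Y Z (g : Y ⟶ Z) (f : X ⟶ Y) :
  (g ◁ runit f) • assoc g f (𝟙 X) = runit (g ∘ f).
Proof.
apply: id_whiskerr_inj; rewrite whiskerrM.
apply: (iso_monic (f := assoc _ _ _)).
rewrite (comp_eqA (assoc_m _ _ _)) -triangle whiskerlM !compcA.
by rewrite -pentagon -[in RHS]triangle (comp_eqA (assoc_l _ _ _)) compcA.
Qed.

Lemma lunit_id X : fwd (lunit (𝟙 X)) = runit (𝟙 X).
Proof.
have e : lunit (𝟙 X ∘ 𝟙 X) = 𝟙 X ◁ lunit (𝟙 X) :> (_ ⇒ _).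
  by apply: (iso_monic (f := lunit _)); rewrite lunit_nat.
apply: id_whiskerr_inj.
by rewrite -lunit_comp -triangle e.
Qed.


Lemma pentagonA X Y Z W V (k : W ⟶ V) (h : Z ⟶ W) (g : Y ⟶ Z) (f : X ⟶ Y) (w : X ⟶ V)
    (a : w ⇒ k ∘ h ∘ g ∘ f) :
  assoc k h (g ∘ f) • assoc (k ∘ h) g f • a =
  (k ◁ assoc h g f) • assoc k (h ∘ g) f • (assoc k h g ▷ f) • a.
Proof. by rewrite (comp_eqA (pentagon _ _ _ _)) !compcA. Qed.

Lemma pentagonV X Y Z W V (k : W ⟶ V) (h : Z ⟶ W) (g : Y ⟶ Z) (f : X ⟶ Y)
    (w : X ⟶ V) (a : w ⇒ k ∘ (h ∘ g ∘ f)) :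
  assoc (k ∘ h) g f • (bwd (assoc k h g) ▷ f) • bwd (assoc k (h ∘ g) f) • a =
  bwd (assoc k h (g ∘ f)) • (k ◁ assoc h g f) • a.
Proof.
apply: (iso_monic (f := assoc k h (g ∘ f))); rewrite fwdKA pentagonA.
rewrite (comp_eqA (g := _ ▷ _) (k := idc _)) ?comp1c ?fwdKA //.
by rewrite -whiskerrM fwdK comp2_id.
Qed.

Lemma lunit_compV X Y Z (g : Y ⟶ Z) (f : X ⟶ Y) :
  assoc (𝟙 Z) g f • (bwd (lunit g) ▷ f) = bwd (lunit (g ∘ f)).
Proof.
apply: (iso_monic (f := lunit _)); rewrite fwdK (comp_eqA (lunit_comp _ _)).
by rewrite -whiskerrM fwdK comp2_id.
Qed.

Lemma runit_compV X Y Z (g : Y ⟶ Z) (f : X ⟶ Y) :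
  bwd (assoc g f (𝟙 X)) • (g ◁ bwd (runit f)) = bwd (runit (g ∘ f)).
Proof.
apply: (iso_monic (f := runit _)); rewrite fwdK -runit_comp compcA fwdKA.
by rewrite -whiskerlM fwdK comp2_id.
Qed.

Section Adjunctions.
Variables X A : B.

Record right_adjoint (f : X ⟶ A) := RightAdjoint {
  radj : A ⟶ X;
  adj_unit : 𝟙 X ⇒ radj ∘ f;
  adj_counit : f ∘ radj ⇒ 𝟙 A;
  adj_triangle_l :
    lunit f • (adj_counit ▷ f) • bwd (assoc f radj f) • (f ◁ adj_unit)
      • bwd (runit f) = idc f;
  adj_triangle_r :
    runit radj • (radj ◁ adj_counit) • assoc radj f radj • (adj_unit ▷ radj)
      • bwd (lunit radj) = idc radj }.

Definition is_map (f : X ⟶ A) : Prop := inhabited (right_adjoint f).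

(* The unit and counit of f ⊣ u acting on generalized elements. *)
Variables (f : X ⟶ A) (u : A ⟶ X).

Definition unit_at (eta : 𝟙 X ⇒ u ∘ f) Z (h : Z ⟶ X) : h ⇒ u ∘ (f ∘ h) :=
  assoc u f h • (eta ▷ h) • bwd (lunit h).

Definition counit_at (eps : f ∘ u ⇒ 𝟙 A) Z (k : Z ⟶ A) : f ∘ (u ∘ k) ⇒ k :=
  lunit k • (eps ▷ k) • bwd (assoc f u k).

Lemma unit_atE eta Z (h : Z ⟶ X) :
  unit_at eta h = assoc u f h • (eta ▷ h) • bwd (lunit h).
Proof. by []. Qed.

Lemma counit_atE eps Z (k : Z ⟶ A) :
  counit_at eps k = lunit k • (eps ▷ k) • bwd (assoc f u k).
Proof. by []. Qed.

Lemma unit_at_nat eta Z (h h' : Z ⟶ X) (a : h ⇒ h') :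
  unit_at eta h' • a = (u ◁ (f ◁ a)) • unit_at eta h.
Proof.
rewrite /unit_at !compcA (bwd_nat (lunit_nat a)).
by rewrite (comp_eqA (exchange _ _)) compcA (comp_eqA (assoc_l _ _ _)) compcA.
Qed.

Lemma counit_at_nat eps Z (k k' : Z ⟶ A) (a : k ⇒ k') :
  counit_at eps k' • (f ◁ (u ◁ a)) = a • counit_at eps k.
Proof.
rewrite /counit_at !compcA (bwd_nat (assoc_l f u a)).
by rewrite (comp_eqA (exchange _ _)) compcA (comp_eqA (lunit_nat _)) compcA.
Qed.

Lemma unit_at_comp eta Z W (h : Z ⟶ X) (z : W ⟶ Z) :
  unit_at eta (h ∘ z) =
  (u ◁ assoc f h z) • assoc u (f ∘ h) z • (unit_at eta h ▷ z).
Proof.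
rewrite /unit_at !whiskerrM -pentagonA -lunit_compV.
by rewrite (comp_eqA (assoc_r _ _ _)) compcA.
Qed.

Lemma counit_at_comp eps Z W (k : Z ⟶ A) (z : W ⟶ Z) :
  counit_at eps (k ∘ z) • (f ◁ assoc u k z) • assoc f (u ∘ k) z =
  counit_at eps k ▷ z.
Proof.
rewrite /counit_at !whiskerrM !compcA.
have -> : bwd (assoc f u (k ∘ z)) • (f ◁ assoc u k z) • assoc f (u ∘ k) z =
    assoc (f ∘ u) k z • (bwd (assoc f u k) ▷ z).
  apply: (iso_monic (f := assoc f u (k ∘ z))); rewrite fwdKA pentagonA.
  by rewrite -whiskerrM fwdK comp2_id compc1.
by rewrite (comp_eqA (esym (assoc_r _ _ _))) compcA (comp_eqA (lunit_comp _ _)).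
Qed.

Lemma triangle_l_at (eta : 𝟙 X ⇒ u ∘ f) (eps : f ∘ u ⇒ 𝟙 A) Z (h : Z ⟶ X) :
  counit_at eps (f ∘ h) • (f ◁ unit_at eta h) =
  (lunit f • (eps ▷ f) • bwd (assoc f u f) • (f ◁ eta) • bwd (runit f)) ▷ h.
Proof.
transitivity ((counit_at eps f • (f ◁ eta) • bwd (runit f)) ▷ h); last first.
  by rewrite /counit_at !compcA.
rewrite whiskerrM -counit_at_comp whiskerrM !compcA (comp_eqA (assoc_m _ _ _)).
rewrite compcA.
rewrite /unit_at !whiskerlM; do 5! [congr (_ • _)].
apply: (iso_monic (f := whiskerl_iso f (lunit h))) => /=.
rewrite (comp_eqA (triangle _ _)) -whiskerrM -whiskerlM !fwdK.
by rewrite !comp2_id.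
Qed.

Lemma triangle_r_at (eta : 𝟙 X ⇒ u ∘ f) (eps : f ∘ u ⇒ 𝟙 A) Z (k : Z ⟶ A) :
  (u ◁ counit_at eps k) • unit_at eta (u ∘ k) =
  (runit u • (u ◁ eps) • assoc u f u • (eta ▷ u) • bwd (lunit u)) ▷ k.
Proof.
rewrite unit_at_comp /counit_at !whiskerlM !compcA.
rewrite (comp_eqA (f := u ◁ assoc f u k) (k := idc _)); last first.
  by rewrite -whiskerlM bwdK comp2_id.
rewrite comp1c (comp_eqA (esym (assoc_m _ _ _))) compcA (comp_eqA (triangle _ _)).
by rewrite /unit_at -!whiskerrM.
Qed.

Lemma triangles_of_elements (eta : 𝟙 X ⇒ u ∘ f) (eps : f ∘ u ⇒ 𝟙 A) :
  counit_at eps (f ∘ 𝟙 X) • (f ◁ unit_at eta (𝟙 X)) = idc _ ->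
  (u ◁ counit_at eps (𝟙 A)) • unit_at eta (u ∘ 𝟙 A) = idc _ ->
  is_map f.
Proof.
rewrite triangle_l_at triangle_r_at -!comp2_id => tl tr.
by split; apply: (RightAdjoint (id_whiskerr_inj tl) (id_whiskerr_inj tr)).
Qed.

End Adjunctions.

Lemma unit_triangle X A (f : X ⟶ A) (F : right_adjoint f) Z (h : Z ⟶ X) :
  counit_at (adj_counit F) (f ∘ h) • (f ◁ unit_at (adj_unit F) h) = idc _.
Proof. by rewrite triangle_l_at adj_triangle_l comp2_id. Qed.

Lemma counit_triangle X A (f : X ⟶ A) (F : right_adjoint f) Z (k : Z ⟶ A) :
  (radj F ◁ counit_at (adj_counit F) k) • unit_at (adj_unit F) (radj F ∘ k) = idc _.
Proof. by rewrite triangle_r_at adj_triangle_r comp2_id. Qed.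

Fact id_triangle_l X :
  lunit (𝟙 X) • (lunit (𝟙 X) ▷ 𝟙 X) • bwd (assoc (𝟙 X) (𝟙 X) (𝟙 X))
    • (𝟙 X ◁ bwd (lunit (𝟙 X))) • bwd (runit (𝟙 X)) = idc (𝟙 X).
Proof.
rewrite -lunit_comp compcA fwdKA (comp_eqA (lunit_nat _)) compcA fwdKA.
by rewrite lunit_id fwdK.
Qed.

Fact id_triangle_r X :
  runit (𝟙 X) • (𝟙 X ◁ lunit (𝟙 X)) • assoc (𝟙 X) (𝟙 X) (𝟙 X)
    • (bwd (lunit (𝟙 X)) ▷ 𝟙 X) • bwd (lunit (𝟙 X)) = idc (𝟙 X).
Proof.
rewrite (comp_eqA (triangle _ _)) -lunit_id.
rewrite (comp_eqA (g := _ ▷ _) (k := idc _)) ?comp1c ?fwdK //.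
by rewrite -whiskerrM fwdK comp2_id.
Qed.

Definition id_adjoint X : right_adjoint (𝟙 X) :=
  RightAdjoint (id_triangle_l X) (id_triangle_r X).

Lemma is_map_id X : is_map (𝟙 X).
Proof. exact: inhabits (id_adjoint X). Qed.

Section CompAdjoint.
Variables (X Y Z : B) (f : X ⟶ Y) (g : Y ⟶ Z).
Variables (F : right_adjoint f) (G : right_adjoint g).
Let u := radj F.
Let v := radj G.

Definition comp_unit : 𝟙 X ⇒ (u ∘ v) ∘ (g ∘ f) :=
  bwd (assoc u v (g ∘ f)) • (u ◁ unit_at (adj_unit G) f) • adj_unit F.

Definition comp_counit : (g ∘ f) ∘ (u ∘ v) ⇒ 𝟙 Z :=
  adj_counit G • (g ◁ counit_at (adj_counit F) v) • assoc g f (u ∘ v).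

Lemma comp_unit_at W (h : W ⟶ X) :
  unit_at comp_unit h =
  bwd (assoc u v (g ∘ f ∘ h)) • (u ◁ (v ◁ bwd (assoc g f h)))
    • (u ◁ unit_at (adj_unit G) (f ∘ h)) • unit_at (adj_unit F) h.
Proof.
apply: (iso_monic (f := assoc u v (g ∘ f ∘ h))); rewrite fwdKA.
rewrite unit_atE /comp_unit !whiskerrM pentagonA !compcA.
rewrite (comp_eqA (g := _ ▷ _) (k := idc _)); last first.
  by rewrite -whiskerrM fwdK comp2_id.
rewrite comp1c (comp_eqA (assoc_m _ _ _)) unit_at_comp !whiskerlM !compcA.
rewrite [in RHS](comp_eqA (f := u ◁ (v ◁ assoc g f h)) (k := idc _)); last first.
  by rewrite -!whiskerlM bwdK !comp2_id.
by rewrite comp1c.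
Qed.

Lemma comp_counit_at W (k : W ⟶ Z) :
  counit_at comp_counit k =
  counit_at (adj_counit G) k • (g ◁ counit_at (adj_counit F) (v ∘ k))
    • (g ◁ (f ◁ assoc u v k)) • assoc g f (u ∘ v ∘ k).
Proof.
apply: (iso_epic (f := assoc (g ∘ f) (u ∘ v) k)).
have e : (g ◁ counit_at (adj_counit F) (v ∘ k)) • (g ◁ (f ◁ assoc u v k))
    • (g ◁ assoc f (u ∘ v) k) = g ◁ (counit_at (adj_counit F) v ▷ k).
  by rewrite -!whiskerlM counit_at_comp.
transitivity (counit_at (adj_counit G) k
    • (g ◁ (counit_at (adj_counit F) v ▷ k)) • assoc g (f ∘ (u ∘ v)) k
    • (assoc g f (u ∘ v) ▷ k)); last first.
  by rewrite -e !compcA pentagon.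
rewrite (comp_eqA (esym (assoc_m _ _ _))).
by rewrite !counit_atE /comp_counit !compcA bwdK bwdKA compc1 !whiskerrM.
Qed.

Lemma is_map_comp : is_map (g ∘ f).
Proof.
apply: (triangles_of_elements (u := u ∘ v) (eta := comp_unit) (eps := comp_counit)).
  set h := 𝟙 X; rewrite comp_counit_at.
  set Y1 := (v ◁ bwd (assoc g f h)) • unit_at (adj_unit G) (f ∘ h).
  transitivity (counit_at (adj_counit G) (g ∘ f ∘ h) • (g ◁ (
      counit_at (adj_counit F) (v ∘ (g ∘ f ∘ h))
      • (f ◁ (assoc u v (g ∘ f ∘ h) • unit_at comp_unit h)))) • assoc g f h).
    generalize (counit_at (adj_counit G) (g ∘ f ∘ h)) => x.
    generalize (counit_at (adj_counit F) (v ∘ (g ∘ f ∘ h))) (unit_at comp_unit h).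
    by move=> y z; rewrite 3!whiskerlM !compcA assoc_l.
  have -> : assoc u v (g ∘ f ∘ h) • unit_at comp_unit h =
      (u ◁ Y1) • unit_at (adj_unit F) h.
    by rewrite comp_unit_at fwdKA /Y1 whiskerlM compcA.
  rewrite (whiskerlM f) (comp_eqA (counit_at_nat _ _)) compcA unit_triangle compc1.
  rewrite /Y1 whiskerlM compcA (comp_eqA (counit_at_nat _ _)) compcA.
  by rewrite (comp_eqA (unit_triangle _ _)) comp1c bwdK.
set k := 𝟙 Z; rewrite comp_unit_at.
rewrite (comp_eqA (esym (bwd_nat (assoc_l u v _)))) compcA.
rewrite (comp_eqA (esym (whiskerlM u _ _))) -whiskerlM.
set Y1 := counit_at (adj_counit F) (v ∘ k) • (f ◁ assoc u v k).
transitivity (bwd (assoc u v k) • (u ◁ ((v ◁ counit_at (adj_counit G) k)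
   • (v ◁ (g ◁ Y1)) • unit_at (adj_unit G) (f ∘ (u ∘ v ∘ k))))
   • unit_at (adj_unit F) (u ∘ v ∘ k)).
  have -> : counit_at comp_counit k • bwd (assoc g f (u ∘ v ∘ k)) =
      counit_at (adj_counit G) k • (g ◁ Y1).
    by rewrite comp_counit_at /Y1 whiskerlM !compcA fwdK compc1.
  rewrite (comp_eqA (esym (whiskerlM u _ _))); congr (_ • (u ◁ _ • _)).
  by rewrite (whiskerlM v) compcA.
rewrite -(unit_at_nat (adj_unit G) Y1) (comp_eqA (counit_triangle _ _)) comp1c.
rewrite /Y1 whiskerlM compcA.
by rewrite -(unit_at_nat (adj_unit F)) (comp_eqA (counit_triangle _ _)) comp1c bwdK.
Qed.

End CompAdjoint.

Definition map_cat X Y : category := full_subcat (@is_map X Y).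

Definition map_id X : map_cat X X := exist _ (𝟙 X) (is_map_id X).

Definition map_comp X Y Z (g : map_cat Y Z) (f : map_cat X Y) : map_cat X Z :=
  exist _ (proj1_sig g ∘ proj1_sig f)
    (let: inhabits F := proj2_sig f in let: inhabits G := proj2_sig g in
     is_map_comp F G).

(* Map B: same objects, the maps as arrows, all 2-cells between them. *)
Definition Map : bicategory := {|
  ob1 := B;
  hom1 := map_cat;
  id1 := map_id;
  comp1 := map_comp;
  comp2 := fun X Y Z g g' f f' b a => b ⋆ a;
  comp2_id := fun X Y Z g f => comp2_id (proj1_sig g) (proj1_sig f);
  interchange := fun X Y Z g g' g'' f f' f'' b' b a' a => interchange b' b a' a;
  assoc := fun X Y Z W h g f =>
    subcat_iso (map_comp (map_comp h g) f) (map_comp h (map_comp g f))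
      (assoc (proj1_sig h) (proj1_sig g) (proj1_sig f));
  lunit := fun X Y f =>
    subcat_iso (map_comp (map_id Y) f) f (lunit (proj1_sig f));
  runit := fun X Y f =>
    subcat_iso (map_comp f (map_id X)) f (runit (proj1_sig f));
  assoc_nat := fun X Y Z W h h' g g' f f' c b a => assoc_nat c b a;
  lunit_nat := fun X Y f f' a => lunit_nat a;
  runit_nat := fun X Y f f' a => runit_nat a;
  pentagon := fun X Y Z W V k h g f =>
    pentagon (proj1_sig k) (proj1_sig h) (proj1_sig g) (proj1_sig f);
  triangle := fun X Y Z g f => triangle (proj1_sig g) (proj1_sig f) |}.

Section Comonads.
Variable A : B.

Record comonad := Comonad {
  cm_arr : A ⟶ A;
  cm_counit : cm_arr ⇒ 𝟙 A;
  cm_comult : cm_arr ⇒ cm_arr ∘ cm_arr;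
  cm_counit_l : lunit cm_arr • (cm_counit ▷ cm_arr) • cm_comult = idc cm_arr;
  cm_counit_r : runit cm_arr • (cm_arr ◁ cm_counit) • cm_comult = idc cm_arr;
  cm_coassoc :
    assoc cm_arr cm_arr cm_arr • (cm_comult ▷ cm_arr) • cm_comult =
    (cm_arr ◁ cm_comult) • cm_comult }.

Variable G : comonad.

Record coalgebra (X : B) := Coalgebra {
  ca_arr :> X ⟶ A;
  ca_act : ca_arr ⇒ cm_arr G ∘ ca_arr;
  ca_counit : lunit ca_arr • (cm_counit G ▷ ca_arr) • ca_act = idc ca_arr;
  ca_coassoc :
    assoc (cm_arr G) (cm_arr G) ca_arr • (cm_comult G ▷ ca_arr) • ca_act =
    (cm_arr G ◁ ca_act) • ca_act }.

Definition is_coalg_hom X (x y : coalgebra X) (a : ca_arr x ⇒ ca_arr y) : Prop :=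
  ca_act y • a = (cm_arr G ◁ a) • ca_act x.

Definition coalg_hom X (x y : coalgebra X) : Type := {a | is_coalg_hom (x := x) (y := y) a}.

Lemma coalg_hom_eq X (x y : coalgebra X) (a b : coalg_hom x y) :
  proj1_sig a = proj1_sig b -> a = b.
Proof. by case: a b => [a ha] [b hb] /= e; apply: subset_eq_compat. Qed.

Arguments coalg_hom_eq {X x y a b} & _.

Fact coalg_idP X (x : coalgebra X) : is_coalg_hom (idc (ca_arr x)).
Proof. by rewrite /is_coalg_hom comp2_id comp1c compc1. Qed.

Fact coalg_compP X (x y z : coalgebra X) (b : coalg_hom y z) (a : coalg_hom x y) :
  is_coalg_hom (x := x) (y := z) (proj1_sig b • proj1_sig a).
Proof.
case: a b => [a ha] [b hb] /=; rewrite /is_coalg_hom (comp_eqA hb).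
by rewrite compcA ha whiskerlM compcA.
Qed.

Definition coalg_cat (X : B) : category := {|
  ob := coalgebra X;
  hom := @coalg_hom X;
  idc := fun x => exist _ _ (coalg_idP x);
  compc := fun x y z b a => exist _ _ (coalg_compP b a);
  comp1c := fun x y a => coalg_hom_eq (comp1c _);
  compc1 := fun x y a => coalg_hom_eq (compc1 _);
  compcA := fun x y z w c b a => coalg_hom_eq (compcA _ _ _) |}.

Section Precomposition.
Variables (T : B) (g : coalgebra T) (X : B).

Definition coalg_comp_act (k : X ⟶ T) : g ∘ k ⇒ cm_arr G ∘ (g ∘ k) :=
  assoc (cm_arr G) g k • (ca_act g ▷ k).

Fact coalg_comp_counit (k : X ⟶ T) :
  lunit (g ∘ k) • (cm_counit G ▷ (g ∘ k)) • coalg_comp_act k = idc (g ∘ k).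
Proof.
rewrite /coalg_comp_act (comp_eqA (esym (assoc_r _ _ _))) compcA.
rewrite (comp_eqA (lunit_comp _ _)) -2!whiskerrM.
by rewrite ca_counit comp2_id.
Qed.

Fact coalg_comp_coassoc (k : X ⟶ T) :
  assoc (cm_arr G) (cm_arr G) (g ∘ k) • (cm_comult G ▷ (g ∘ k))
    • coalg_comp_act k =
  (cm_arr G ◁ coalg_comp_act k) • coalg_comp_act k.
Proof.
rewrite /coalg_comp_act (comp_eqA (esym (assoc_r _ _ _))) !compcA pentagonA.
rewrite whiskerlM compcA (comp_eqA (esym (assoc_m _ _ _))) !compcA.
by rewrite -!whiskerrM ca_coassoc.
Qed.

Definition coalg_comp (k : X ⟶ T) : coalgebra X :=
  Coalgebra (coalg_comp_counit k) (coalg_comp_coassoc k).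

Fact coalg_whiskerP (k k' : X ⟶ T) (a : k ⇒ k') :
  is_coalg_hom (x := coalg_comp k) (y := coalg_comp k') (g ◁ a).
Proof.
rewrite /is_coalg_hom /= /coalg_comp_act compcA exchange.
by rewrite (comp_eqA (assoc_l _ _ _)) compcA.
Qed.

Definition coalg_functor : functor (X ⟶ T) (coalg_cat X) := {|
  fobj := coalg_comp : (X ⟶ T) -> coalg_cat X;
  fmap := fun k k' a => exist _ _ (coalg_whiskerP a);
  fmap1 := fun k => coalg_hom_eq (comp2_id _ _);
  fmapM := fun k k' k'' b a => coalg_hom_eq (whiskerlM _ _ _) |}.

End Precomposition.

Definition is_EM_object (T : B) (g : coalgebra T) : Prop :=
  forall X : B, inhabited (equivalence (coalg_functor g X)).

End Comonads.

(* The comonad gg^*, with comultiplication g η g^*, and its coalgebra (g, g η). *)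
Section MapComonad.
Variables (T A : B) (g : T ⟶ A) (M : right_adjoint g).
Let u := radj M.
Let eta := adj_unit M.
Let eps := adj_counit M.

Definition map_comult : g ∘ u ⇒ (g ∘ u) ∘ (g ∘ u) :=
  bwd (assoc g u (g ∘ u)) • (g ◁ (assoc u g u • (eta ▷ u) • bwd (lunit u))).

Fact map_counit_l :
  lunit (g ∘ u) • (eps ▷ (g ∘ u)) • map_comult = idc (g ∘ u).
Proof.
by rewrite /map_comult -[RHS](unit_triangle M u) counit_atE unit_atE !compcA.
Qed.

Fact map_counit_r :
  runit (g ∘ u) • (g ∘ u ◁ eps) • map_comult = idc (g ∘ u).
Proof.
rewrite /map_comult (comp_eqA (esym (bwd_nat (assoc_l g u eps)))).
rewrite -runit_comp !compcA fwdKA -!whiskerlM.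
by rewrite (adj_triangle_r M) comp2_id.
Qed.

Fact map_coassoc :
  assoc (g ∘ u) (g ∘ u) (g ∘ u) • (map_comult ▷ (g ∘ u)) • map_comult =
  (g ∘ u ◁ map_comult) • map_comult.
Proof.
rewrite /map_comult -unit_atE whiskerrM whiskerlM !compcA.
rewrite (comp_eqA (esym (bwd_nat (assoc_m _ _ _)))) compcA pentagonV.
rewrite !(comp_eqA (esym (bwd_nat (assoc_l _ _ _)))) !compcA.
rewrite (comp_eqA (esym (bwd_nat (assoc_l _ _ _)))) compcA.
rewrite -!whiskerlM -(unit_at_nat eta (unit_at eta u)).
rewrite unit_at_comp !compcA (comp_eqA (g := u ◁ bwd _) (k := idc _)) ?comp1c //.
by rewrite -whiskerlM bwdK comp2_id.
Qed.

Definition map_coact : g ⇒ (g ∘ u) ∘ g :=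
  bwd (assoc g u g) • (g ◁ eta) • bwd (runit g).

Fact map_coact_counit : lunit g • (eps ▷ g) • map_coact = idc g.
Proof. exact: adj_triangle_l. Qed.

Fact map_coact_coassoc :
  assoc (g ∘ u) (g ∘ u) g • (map_comult ▷ g) • map_coact =
  (g ∘ u ◁ map_coact) • map_coact.
Proof.
have e1 : unit_at eta (𝟙 T) = (u ◁ bwd (runit g)) • eta.
  apply: (iso_monic (f := whiskerl_iso u (runit g))) => /=.
  rewrite -compcA -whiskerlM fwdK comp2_id comp1c unit_atE.
  rewrite (comp_eqA (runit_comp _ _)) (comp_eqA (runit_nat _)) compcA -lunit_id.
  by rewrite fwdK compc1.
rewrite /map_coact {1}/map_comult -unit_atE whiskerrM !compcA.
rewrite (comp_eqA (esym (bwd_nat (assoc_m _ _ _)))) compcA pentagonV.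
rewrite !whiskerlM !compcA.
do 3! [rewrite (comp_eqA (esym (bwd_nat (assoc_l _ _ _)))) compcA].
congr (_ • _); rewrite !(comp_eqA (esym (whiskerlM g _ _))) !compcA.
congr ((g ◁ _) • _); rewrite -e1 -(unit_at_nat eta eta) unit_at_comp.
rewrite !compcA (comp_eqA (g := u ◁ bwd _) (k := idc _)) ?comp1c //.
by rewrite -whiskerlM bwdK comp2_id.
Qed.

Definition map_comonad : comonad A :=
  Comonad map_counit_l map_counit_r map_coassoc.

Definition map_coalgebra : coalgebra map_comonad T :=
  @Coalgebra A map_comonad T g map_coact map_coact_counit map_coact_coassoc.

End MapComonad.

End Bicategories.

Notation "X ⟶ₘ Y" := (@hom1 (Map _) X Y)
  (at level 75, no associativity) : bicat_scope.

Definition arr (B : bicategory) (X Y : B) (f : @hom1 (Map B) X Y) : X ⟶ Y :=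
  proj1_sig f.

Definition adjoint_choice (B : bicategory) : Type :=
  forall (X A : B) (f : @hom1 (Map B) X A), right_adjoint (arr f).

Definition comonadic (B : bicategory) (ra : adjoint_choice B) (X A : B)
    (g : @hom1 (Map B) X A) : Prop :=
  is_EM_object (map_coalgebra (ra X A g)).

Section FiniteProducts.
Variable C : bicategory.
Implicit Types X Y Z P : C.

Definition cone_functor X Y P (p : P ⟶ X) (r : P ⟶ Y) Z :
    functor (Z ⟶ P) (prod_cat (Z ⟶ X) (Z ⟶ Y)) := {|
  fobj := fun h => (p ∘ h, r ∘ h) : prod_cat (Z ⟶ X) (Z ⟶ Y);
  fmap := fun h h' a => (p ◁ a, r ◁ a);
  fmap1 := fun h => f_equal2 pair (comp2_id p h) (comp2_id r h);
  fmapM := fun h h' h'' b a =>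
    f_equal2 pair (whiskerlM p b a) (whiskerlM r b a) |}.

Record binary_product X Y := BinaryProduct {
  prd : C;
  proj_p : prd ⟶ X;
  proj_r : prd ⟶ Y;
  prd_universal : forall Z, equivalence (cone_functor proj_p proj_r Z) }.

Record terminal_object := TerminalObject {
  trm : C;
  trm_universal : forall Z, equivalence (to_unit_cat (Z ⟶ trm)) }.

Record finite_products := FiniteProducts {
  fp_prod : forall X Y, binary_product X Y;
  fp_term : terminal_object }.

Variable FP : finite_products.

Definition prodo X Y : C := prd (fp_prod FP X Y).
Definition pp X Y : prodo X Y ⟶ X := proj_p (fp_prod FP X Y).
Definition rr X Y : prodo X Y ⟶ Y := proj_r (fp_prod FP X Y).

Arguments pp {X Y}.
Arguments rr {X Y}.

Definition pair1 Z X Y (f : Z ⟶ X) (g : Z ⟶ Y) : Z ⟶ prodo X Y :=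
  lift_ob (prd_universal (fp_prod FP X Y) Z) (f, g).

Definition pair_p Z X Y (f : Z ⟶ X) (g : Z ⟶ Y) : pp ∘ pair1 f g ≅ f :=
  fst_iso (lift_iso (prd_universal (fp_prod FP X Y) Z) (f, g)).

Definition pair_r Z X Y (f : Z ⟶ X) (g : Z ⟶ Y) : rr ∘ pair1 f g ≅ g :=
  snd_iso (lift_iso (prd_universal (fp_prod FP X Y) Z) (f, g)).

(* The unique h ≅ ⟨f, g⟩ compatible with the projections. *)
Definition pair_eta Z X Y (h : Z ⟶ prodo X Y) (f : Z ⟶ X) (g : Z ⟶ Y)
    (a : pp ∘ h ≅ f) (b : rr ∘ h ≅ g) : h ≅ pair1 f g :=
  let F := cone_functor pp rr Z in
  reflect_iso (prd_universal (fp_prod FP X Y) Z)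
    (pair_iso (F h) (F (pair1 f g)) (comp_iso (inv_iso (pair_p f g)) a)
                                    (comp_iso (inv_iso (pair_r f g)) b)).

Definition pair_p_comp W Z X Y (f : Z ⟶ X) (g : Z ⟶ Y) (k : W ⟶ Z) :
    pp ∘ (pair1 f g ∘ k) ≅ f ∘ k :=
  comp_iso (whiskerr_iso k (pair_p f g)) (inv_iso (assoc pp (pair1 f g) k)).

Definition pair_r_comp W Z X Y (f : Z ⟶ X) (g : Z ⟶ Y) (k : W ⟶ Z) :
    rr ∘ (pair1 f g ∘ k) ≅ g ∘ k :=
  comp_iso (whiskerr_iso k (pair_r f g)) (inv_iso (assoc rr (pair1 f g) k)).

Definition diag X : X ⟶ prodo X X := pair1 (𝟙 X) (𝟙 X).

Definition times X X' Y Y' (f : X ⟶ X') (g : Y ⟶ Y') : prodo X Y ⟶ prodo X' Y' :=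
  pair1 (f ∘ pp) (g ∘ rr).

Definition assoc_map X Y Z : prodo (prodo X Y) Z ⟶ prodo X (prodo Y Z) :=
  pair1 (pp ∘ pp) (pair1 (rr ∘ pp) rr).

(* (f × g) d ≅ ⟨f, g⟩ *)
Definition times_diag X Y Z (f : X ⟶ Y) (g : X ⟶ Z) :
    times f g ∘ diag X ≅ pair1 f g :=
  pair_eta
    (comp_iso (runit f) (comp_iso (whiskerl_iso f (pair_p _ _))
      (comp_iso (assoc f pp (diag X)) (pair_p_comp (f ∘ pp) (g ∘ rr) (diag X)))))
    (comp_iso (runit g) (comp_iso (whiskerl_iso g (pair_r _ _))
      (comp_iso (assoc g rr (diag X)) (pair_r_comp (f ∘ pp) (g ∘ rr) (diag X))))).

(* a ⟨⟨f, g⟩, h⟩ ≅ ⟨f, ⟨g, h⟩⟩ *)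
Definition assoc_pair W X Y Z (f : W ⟶ X) (g : W ⟶ Y) (h : W ⟶ Z) :
    assoc_map X Y Z ∘ pair1 (pair1 f g) h ≅ pair1 f (pair1 g h) :=
  let t := pair1 (pair1 f g) h in
  pair_eta
    (comp_iso (pair_p f g) (comp_iso (whiskerl_iso pp (pair_p _ _))
      (comp_iso (assoc pp pp t) (pair_p_comp (pp ∘ pp) (pair1 (rr ∘ pp) rr) t))))
    (comp_iso
      (pair_eta
        (comp_iso (pair_r f g) (comp_iso (whiskerl_iso rr (pair_p _ _))
          (comp_iso (assoc rr pp t) (pair_p_comp (rr ∘ pp) rr t))))
        (comp_iso (pair_r _ _) (pair_r_comp (rr ∘ pp) rr t)))
      (pair_r_comp (pp ∘ pp) (pair1 (rr ∘ pp) rr) t)).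

(* The canonical isomorphism (1 × d) d ≅ a ((d × 1) d), through ⟨1, ⟨1, 1⟩⟩. *)
Definition diag_coassoc X :
    times (𝟙 X) (diag X) ∘ diag X ≅
    assoc_map X X X ∘ (times (diag X) (𝟙 X) ∘ diag X) :=
  comp_iso (whiskerl_iso (assoc_map X X X) (inv_iso (times_diag (diag X) (𝟙 X))))
    (comp_iso (inv_iso (assoc_pair (𝟙 X) (𝟙 X) (𝟙 X)))
      (times_diag (𝟙 X) (diag X))).

End FiniteProducts.

(* The transpose of α : m h ⇒ k under m ⊣ m^*. *)
Definition transpose (B : bicategory) (X A Z : B) (m : X ⟶ A) (M : right_adjoint m)
    (h : Z ⟶ X) (k : Z ⟶ A) (a : m ∘ h ⇒ k) : h ⇒ radj M ∘ k :=
  (radj M ◁ a) • unit_at (adj_unit M) h.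

(* The mate h f^* ⇒ v k of θ : g h ⇒ k f under f ⊣ f^* and g ⊣ v; it involves
   only the unit eta of the latter adjunction. *)
Definition mate (B : bicategory) (X Y Z W : B)
    (f : X ⟶ Y) (F : right_adjoint f)
    (g : Z ⟶ W) (v : W ⟶ Z) (eta : 𝟙 Z ⇒ v ∘ g)
    (h : X ⟶ Z) (k : Y ⟶ W) (theta : g ∘ h ⇒ k ∘ f) : h ∘ radj F ⇒ v ∘ k :=
  (v ◁ (runit k • (k ◁ adj_counit F) • assoc k f (radj F) • (theta ▷ radj F)
         • bwd (assoc g h (radj F))))
    • unit_at eta (h ∘ radj F).

Section Tensor.
Variables (B : bicategory) (ra : adjoint_choice B).
Variable MP : finite_products (Map B).
Variable LP : forall X A : B, cat_products (X ⟶ A).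

Implicit Types X Y A : B.

Definition tensor_ob X Y : B := prodo MP X Y.
Local Notation "X ⊗ Y" := (tensor_ob X Y) (at level 39, no associativity).

Definition pt X Y : X ⊗ Y ⟶ X := arr (pp MP X Y).
Definition rt X Y : X ⊗ Y ⟶ Y := arr (rr MP X Y).
Definition pt_adj X Y : right_adjoint (pt X Y) := ra (pp MP X Y).
Definition rt_adj X Y : right_adjoint (rt X Y) := ra (rr MP X Y).

Definition tensor X Y A A' (R : X ⟶ A) (S : Y ⟶ A') : X ⊗ Y ⟶ A ⊗ A' :=
  meet (LP (X ⊗ Y) (A ⊗ A'))
    (radj (pt_adj A A') ∘ (R ∘ pt X Y)) (radj (rt_adj A A') ∘ (S ∘ rt X Y)).
Local Notation "R ⊠ S" := (tensor R S) (at level 39, no associativity).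

Definition tensor_p X Y A A' (R : X ⟶ A) (S : Y ⟶ A') :
    R ⊠ S ⇒ radj (pt_adj A A') ∘ (R ∘ pt X Y) :=
  fstc (LP (X ⊗ Y) (A ⊗ A')) _ _.

Definition tensor_r X Y A A' (R : X ⟶ A) (S : Y ⟶ A') :
    R ⊠ S ⇒ radj (rt_adj A A') ∘ (S ∘ rt X Y) :=
  sndc (LP (X ⊗ Y) (A ⊗ A')) _ _.

Definition tensor_pair X Y A A' (R : X ⟶ A) (S : Y ⟶ A') (Q : X ⊗ Y ⟶ A ⊗ A')
    (a : Q ⇒ radj (pt_adj A A') ∘ (R ∘ pt X Y))
    (b : Q ⇒ radj (rt_adj A A') ∘ (S ∘ rt X Y)) : Q ⇒ R ⊠ S :=
  pairc (LP (X ⊗ Y) (A ⊗ A')) a b.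

Definition tensor2 X Y A A' (R R' : X ⟶ A) (S S' : Y ⟶ A')
    (a : R ⇒ R') (b : S ⇒ S') : R ⊠ S ⇒ R' ⊠ S' :=
  tensor_pair ((radj (pt_adj A A') ◁ (a ▷ pt X Y)) • tensor_p R S)
              ((radj (rt_adj A A') ◁ (b ▷ rt X Y)) • tensor_r R S).

Definition tensor_id X Y : 𝟙 (X ⊗ Y) ⇒ 𝟙 X ⊠ 𝟙 Y :=
  tensor_pair
    ((radj (pt_adj X Y) ◁ bwd (lunit (pt X Y))) • adj_unit (pt_adj X Y))
    ((radj (rt_adj X Y) ◁ bwd (lunit (rt X Y))) • adj_unit (rt_adj X Y)).

(* (u (R' q)) (q^* (R s)) ⇒ u ((R' R) s), by the counit of q ⊣ q^*. *)
Definition cancel_mid (P X Q A A' V : B) (u : A' ⟶ V) (R' : A ⟶ A')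
    (q : Q ⟶ A) (M : right_adjoint q) (R : X ⟶ A) (s : P ⟶ X) :
    (u ∘ (R' ∘ q)) ∘ (radj M ∘ (R ∘ s)) ⇒ u ∘ (R' ∘ R ∘ s) :=
  (u ◁ (bwd (assoc R' R s) • (R' ◁ counit_at (adj_counit M) (R ∘ s))
         • assoc R' q (radj M ∘ (R ∘ s))))
    • assoc u (R' ∘ q) (radj M ∘ (R ∘ s)).

Definition tensor_comp X Y A1 A2 C1 C2 (R' : A1 ⟶ C1) (S' : A2 ⟶ C2)
    (R : X ⟶ A1) (S : Y ⟶ A2) : (R' ⊠ S') ∘ (R ⊠ S) ⇒ (R' ∘ R) ⊠ (S' ∘ S) :=
  tensor_pair
    (cancel_mid (radj (pt_adj C1 C2)) R' (pt_adj A1 A2) R (pt X Y)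
      • (tensor_p R' S' ⋆ tensor_p R S))
    (cancel_mid (radj (rt_adj C1 C2)) S' (rt_adj A1 A2) S (rt X Y)
      • (tensor_r R' S' ⋆ tensor_r R S)).

End Tensor.

(* ⊗ and I are lax functors for any map_products and local_products (the lax
   functor equations are automatic), so that being pseudofunctors only means that
   their constraints are invertible. *)
Record cartesian (B : bicategory) (ra : adjoint_choice B) := Cartesian {
  map_products : finite_products (Map B);
  local_products : forall X A : B, cat_products (X ⟶ A);
  tensor_id_iso : forall X Y : B,
    is_iso (tensor_id ra map_products local_products X Y);
  tensor_comp_iso : forall (X Y A1 A2 C1 C2 : B)
    (R' : A1 ⟶ C1) (S' : A2 ⟶ C2) (R : X ⟶ A1) (S : Y ⟶ A2),
    is_iso (tensor_comp ra map_products local_products R' S' R S);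
  unit_id_iso :
    let I : B := trm (fp_term map_products) in
    is_iso (bang (local_products I I) (𝟙 I));
  unit_comp_iso :
    let I : B := trm (fp_term map_products) in
    is_iso (bang (local_products I I)
             (top (local_products I I) ∘ top (local_products I I))) }.

Section Frobenius.
Variables (B : bicategory) (ra : adjoint_choice B) (K : cartesian ra).

Let MP := map_products K.

Local Notation "X ⊗ Y" := (tensor_ob MP X Y) (at level 39, no associativity).
Local Notation "R ⊠ S" := (tensor ra MP (local_products K) R S)
  (at level 39, no associativity).

(* The unit of f ⊗ g ⊣ f^* ⊗ g^*, obtained by applying the pseudofunctor ⊗. *)
Definition tensor_unit (X Y A A' : B) (f : X ⟶ A) (F : right_adjoint f)
    (g : Y ⟶ A') (G : right_adjoint g) :
    𝟙 (X ⊗ Y) ⇒ (radj F ⊠ radj G) ∘ (f ⊠ g) :=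
  inv (tensor_comp_iso K (radj F) (radj G) f g)
    • tensor2 ra MP (local_products K) (adj_unit F) (adj_unit G)
    • tensor_id ra MP (local_products K) X Y.

(* The comparison f × g ⇒ f ⊗ g for maps f and g. *)
Definition times_tensor (X Y A A' : B) (f : X ⟶ₘ A) (g : Y ⟶ₘ A') :
    arr (times MP f g) ⇒ arr f ⊠ arr g :=
  tensor_pair (local_products K)
    (transpose (pt_adj ra MP A A') (fwd (pair_p MP (f ∘ pp MP X Y) (g ∘ rr MP X Y))))
    (transpose (rt_adj ra MP A A') (fwd (pair_r MP (f ∘ pp MP X Y) (g ∘ rr MP X Y)))).

Variable A : B.

Let d : A ⟶ A ⊗ A := arr (diag MP A).
Let d_adj : right_adjoint d := ra (diag MP A).
Let a : (A ⊗ A) ⊗ A ⟶ A ⊗ (A ⊗ A) := arr (assoc_map MP A A A).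

(* θ is the canonical isomorphism (1 ⊗ d) d ≅ a ((d ⊗ 1) d): the one that the
   comparisons 1 × d ⇒ 1 ⊗ d and d × 1 ⇒ d ⊗ 1, which are invertible, transport
   from the isomorphism (1 × d) d ≅ a ((d × 1) d) given by the products of Map B. *)
Definition is_coassoc (theta : (𝟙 A ⊠ d) ∘ d ⇒ a ∘ ((d ⊠ 𝟙 A) ∘ d)) : Prop :=
  invertible theta /\
  theta • (times_tensor (@id1 (Map B) A) (diag MP A) ▷ d) =
  (a ◁ (times_tensor (diag MP A) (@id1 (Map B) A) ▷ d)) • diag_coassoc MP A.

Definition frobenius_mate (theta : (𝟙 A ⊠ d) ∘ d ⇒ a ∘ ((d ⊠ 𝟙 A) ∘ d)) :
    d ∘ radj d_adj ⇒ (𝟙 A ⊠ radj d_adj) ∘ (a ∘ (d ⊠ 𝟙 A)) :=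
  mate d_adj (tensor_unit (id_adjoint A) d_adj)
    (bwd (assoc a (d ⊠ 𝟙 A) d) • theta).

Definition frobenius : Prop :=
  exists theta : (𝟙 A ⊠ d) ∘ d ⇒ a ∘ ((d ⊠ 𝟙 A) ∘ d),
    unique is_coassoc theta /\ invertible (frobenius_mate theta).

End Frobenius.

(* Main.v *)
(** If g is comonadic, composition with g reflects invertibility of 2-cells, so
    here every map does.  For S : Y → Y' the local projection has a transpose
    r (1_X ⊗ S) → S r; it is invertible, because it is so for t ⊗ S when t : X → I
    is a map (as 1_I = ⊤ makes t p terminal and r : I ⊗ Y' → Y' is an equivalence)
    and (t ⊗ 1) (1 ⊗ S) ≅ t ⊗ S.  Composing with r then shows first that
    1 × d → 1 ⊗ d is invertible, so that the coassociativity cell exists, and next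
    that the Frobenius cell is: its composite with r is, up to isomorphism, the
    mate under d ⊣ d^* of an invertible cell d (r d) ≅ (r a (d ⊗ 1)) d, in which
    r d ≅ 1 and r a (d ⊗ 1) ≅ 1, and such a mate is invertible. *)
From mathcomp Require Import ssreflect ssrfun.
Require Import Defs.

Set Implicit Arguments.
Unset Strict Implicit.
Unset Printing Implicit Defensive.

(** * Invertible arrows and terminal objects in a category *)

Section Invertible.
Variable C : category.
Implicit Types x y z : C.

Lemma invertible_fwd x y (f : x ≅ y) : invertible f.
Proof. by split; apply: iso_is_iso. Qed.

Lemma invertible_bwd x y (f : x ≅ y) : invertible (bwd f).
Proof. exact: (invertible_fwd (inv_iso f)). Qed.

Lemma invertible_iso x y (f : x ⇒ y) : invertible f -> exists i : x ≅ y, fwd i = f.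
Proof. by case=> i; exists (Iso i). Qed.

Lemma invertible_comp x y z (g : y ⇒ z) (f : x ⇒ y) :
  invertible g -> invertible f -> invertible (g • f).
Proof.
by move=> /invertible_iso[j <-] /invertible_iso[i <-]; apply: (invertible_fwd (comp_iso j i)).
Qed.

Lemma invertible_cancel_l x y z (g : y ⇒ z) (f : x ⇒ y) :
  invertible g -> invertible (g • f) -> invertible f.
Proof.
move=> /invertible_iso[j <-] h; rewrite -(bwdKA j f).
exact: (invertible_comp (invertible_bwd j) h).
Qed.

Lemma invertible_cancel_r x y z (g : y ⇒ z) (f : x ⇒ y) :
  invertible f -> invertible (g • f) -> invertible g.
Proof.
move=> /invertible_iso[i <-] h; rewrite -(compc1 g) -(fwdK i) -compcA.
exact: (invertible_comp h (invertible_bwd i)).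
Qed.

Lemma invertible_cancel_eq x y z (g : y ⇒ z) (f : x ⇒ y) (h : x ⇒ z) :
  g • f = h -> invertible h -> invertible f -> invertible g.
Proof. by move=> <- ih i; apply: invertible_cancel_r ih. Qed.

Definition terminal x : Prop := forall z, exists f : z ⇒ x, forall g : z ⇒ x, g = f.

Lemma terminal_eq x z (f g : z ⇒ x) : terminal x -> f = g.
Proof. by move=> /(_ z)[h hE]; rewrite (hE f) (hE g). Qed.

Lemma terminal_of_iso_top (L : cat_products C) x : is_iso (bang L x) -> terminal x.
Proof.
move=> i z; exists (inv i • bang L z) => g.
by rewrite -(comp1c g) -(inv_l i) compcA (bang_uniq (_ • g)).
Qed.

Variable L : cat_products C.

Lemma invertible_sndc x y : terminal x -> invertible (sndc L x y).
Proof.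
move=> tx; have [b _] := tx y.
split; apply: (IsIso (inv := pairc L b (idc y))); last by rewrite snd_pairc.
rewrite [LHS](pairc_uniq (c := L)) [RHS](pairc_uniq (c := L)).
congr pairc; first exact: terminal_eq.
by rewrite -compcA snd_pairc comp1c compc1.
Qed.

Lemma invertible_fstc x y : terminal y -> invertible (fstc L x y).
Proof.
move=> ty; have [b _] := ty x.
split; apply: (IsIso (inv := pairc L (idc x) b)); last by rewrite fst_pairc.
rewrite [LHS](pairc_uniq (c := L)) [RHS](pairc_uniq (c := L)).
congr pairc; last exact: terminal_eq.
by rewrite -compcA fst_pairc comp1c compc1.
Qed.

End Invertible.


(** * Invertible 2-cells and comonadic maps *)

Section Bicategory.
Variable B : bicategory.
Implicit Types X Y Z W A P Q : B.

Lemma invertible_whiskerl X Y Z (g : Y ⟶ Z) (f f' : X ⟶ Y) (a : f ⇒ f') :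
  invertible a -> invertible (g ◁ a).
Proof. by move=> /invertible_iso[i <-]; apply: (invertible_fwd (whiskerl_iso g i)). Qed.

Lemma invertible_whiskerr X Y Z (g g' : Y ⟶ Z) (f : X ⟶ Y) (b : g ⇒ g') :
  invertible b -> invertible (b ▷ f).
Proof. by move=> /invertible_iso[i <-]; apply: (invertible_fwd (whiskerr_iso f i)). Qed.

Lemma invertible_id_whiskerl X Y (f f' : X ⟶ Y) (a : f ⇒ f') :
  invertible (𝟙 Y ◁ a) -> invertible a.
Proof.
move=> h; apply: (invertible_cancel_r (invertible_fwd (lunit f))).
by rewrite -lunit_nat; apply: invertible_comp h; apply: invertible_fwd.
Qed.

Lemma invertible_id_whiskerr X Y (f f' : X ⟶ Y) (a : f ⇒ f') :
  invertible (a ▷ 𝟙 X) -> invertible a.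
Proof.
move=> h; apply: (invertible_cancel_r (invertible_fwd (runit f))).
by rewrite -runit_nat; apply: invertible_comp h; apply: invertible_fwd.
Qed.

Lemma invertible_counit_at X A (f : X ⟶ A) (u : A ⟶ X) (eps : f ∘ u ⇒ 𝟙 A) Z (k : Z ⟶ A) :
  invertible eps -> invertible (counit_at eps k).
Proof.
move=> h; apply: invertible_comp; first exact: invertible_fwd.
apply: invertible_comp; last exact: invertible_bwd.
exact: invertible_whiskerr.
Qed.

Lemma invertible_unit_at X A (f : X ⟶ A) (u : A ⟶ X) (eta : 𝟙 X ⇒ u ∘ f) Z (h : Z ⟶ X) :
  invertible eta -> invertible (unit_at eta h).
Proof.
move=> i; apply: invertible_comp; first exact: invertible_fwd.
apply: invertible_comp; last exact: invertible_bwd.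
exact: invertible_whiskerr.
Qed.

Lemma coalg_hom_bwd A (G : comonad A) Z (x y : coalgebra G Z) (i : ca_arr x ≅ ca_arr y) :
  is_coalg_hom (x := x) (y := y) i -> is_coalg_hom (x := y) (y := x) (bwd i).
Proof.
rewrite /is_coalg_hom => H; apply: (iso_epic (f := i)).
by rewrite !compcA bwdK compc1 H -compcA -whiskerlM bwdK comp2_id comp1c.
Qed.

(** The inverse of [g ◁ a] is again a morphism of coalgebras, so the image of [a] under the
    comparison functor is invertible, and a fully faithful functor reflects this. *)
Lemma comonadic_conservative (ra : adjoint_choice B) X A (g : @hom1 (Map B) X A) Z
    (h k : Z ⟶ X) (a : h ⇒ k) :
  comonadic ra g -> invertible (arr g ◁ a) -> invertible a.
Proof.
move=> /(_ Z)[E] /invertible_iso[i iE].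
set F := coalg_functor _ _ in E.
have bP : is_coalg_hom (x := F k) (y := F h) (bwd i).
  by apply: coalg_hom_bwd; rewrite iE; apply: coalg_whiskerP.
pose b : F k ⇒ F h := exist _ _ bP.
have l : b • fmap F a = idc (F h) by apply: coalg_hom_eq; rewrite /= -iE bwdK.
have r : fmap F a • b = idc (F k) by apply: coalg_hom_eq; rewrite /= -iE fwdK.
split; apply: (IsIso (inv := lift_hom E b)).
  by rewrite -[LHS](lift_fmap E) fmapM fmap_lift l -fmap1 lift_fmap.
by rewrite -[LHS](lift_fmap E) fmapM fmap_lift r -fmap1 lift_fmap.
Qed.

(** * Transposes and mates under an adjunction [f ⊣ u] *)

Section Transpose.
Variables (X A : B) (f : X ⟶ A) (M : right_adjoint f).
Let u := radj M.
Let eta := adj_unit M.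
Let eps := adj_counit M.

Lemma transposeK Z (h : Z ⟶ X) (k : Z ⟶ A) (a : f ∘ h ⇒ k) :
  counit_at eps k • (f ◁ transpose M a) = a.
Proof.
by rewrite /transpose whiskerlM (comp_eqA (counit_at_nat _ _)) compcA unit_triangle compc1.
Qed.

Lemma transposeVK Z (h : Z ⟶ X) (k : Z ⟶ A) (b : h ⇒ u ∘ k) :
  transpose M (counit_at eps k • (f ◁ b)) = b.
Proof.
by rewrite /transpose whiskerlM compcA -unit_at_nat (comp_eqA (counit_triangle _ _)) comp1c.
Qed.

Lemma transpose_inj Z (h : Z ⟶ X) (k : Z ⟶ A) (b c : h ⇒ u ∘ k) :
  counit_at eps k • (f ◁ b) = counit_at eps k • (f ◁ c) -> b = c.
Proof. by move=> e; rewrite -(transposeVK b) e transposeVK. Qed.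

Lemma transpose_l Z (h : Z ⟶ X) (k k' : Z ⟶ A) (b : k ⇒ k') (a : f ∘ h ⇒ k) :
  transpose M (b • a) = (u ◁ b) • transpose M a.
Proof. by rewrite /transpose whiskerlM compcA. Qed.

Lemma transpose_r Z (h h' : Z ⟶ X) (k : Z ⟶ A) (a : f ∘ h ⇒ k) (b : h' ⇒ h) :
  transpose M (a • (f ◁ b)) = transpose M a • b.
Proof. by rewrite /transpose whiskerlM compcA -unit_at_nat [in RHS]compcA. Qed.

Lemma terminal_radj Z (k : Z ⟶ A) : terminal k -> terminal (u ∘ k).
Proof.
move=> tk h; have [a aE] := tk (f ∘ h); exists (transpose M a) => b.
by rewrite -(transposeVK b); congr transpose; apply: aE.
Qed.

(** Precomposing with [u] gives a bijection between cells [R ⇒ f] and cells [R u ⇒ 1], and there is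
    exactly one of the latter. The witness is the mate of that cell. *)
Lemma map_terminal : terminal (𝟙 A) -> terminal f.
Proof.
move=> t1 R; have [c cE] := t1 (R ∘ u).
exists (lunit f • (c ▷ f) • bwd (assoc R u f) • (R ◁ eta) • bwd (runit R)) => a.
rewrite -[c](cE (eps • (a ▷ u))) whiskerrM !compcA.
rewrite (comp_eqA (esym (bwd_nat (assoc_r _ _ _)))) compcA.
rewrite (comp_eqA (exchange _ _)) !compcA.
rewrite -(bwd_nat (runit_nat a)).
have e := adj_triangle_l M; by rewrite -[LHS]comp1c -[in LHS]e !compcA.
Qed.

(* Sending a cell [f ⇒ f] to its mate [u ⇒ u] is contravariantly functorial. *)
Lemma invertible_transpose_endo (b : f ⇒ f) :
  invertible b -> invertible (transpose M (eps • (b ▷ u))).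
Proof.
have epsE : counit_at eps (𝟙 A) = eps • (f ◁ runit u).
  by rewrite /counit_at lunit_id (comp_eqA (runit_nat _)) compcA -runit_comp !compcA fwdK compc1.
(* [t c] is the mate of [c] with the right unit removed; by [t_inj] the equation [tE] determines it,
   which yields [tM] and [t1]. *)
pose t (c : f ⇒ f) : u ⇒ u := runit u • transpose M (eps • (c ▷ u)).
have tE c : eps • (f ◁ t c) = eps • (c ▷ u).
  by rewrite /t whiskerlM -compcA -epsE transposeK.
have t_inj (a a' : u ⇒ u) : eps • (f ◁ a) = eps • (f ◁ a') -> a = a'.
  move=> e; apply: (iso_monic (f := inv_iso (runit u))); apply: transpose_inj.
  have cE (x : u ⇒ u) : counit_at eps (𝟙 A) • (f ◁ (inv_iso (runit u) • x)) = eps • (f ◁ x).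
    by rewrite epsE compcA -whiskerlM fwdKA.
  by rewrite [LHS]cE e -[LHS]cE.
have tM c c' : t c • t c' = t (c' • c).
  apply: t_inj; rewrite whiskerlM -compcA tE compcA exchange -compcA !tE compcA.
  by rewrite -whiskerrM.
have t1 : t (idc f) = idc u by apply: t_inj; rewrite tE !comp2_id.
case=> [[c l r]]; apply: (invertible_cancel_l (invertible_fwd (runit u))).
by split; apply: (IsIso (inv := t c)); rewrite -/(t b) tM ?l ?r t1.
Qed.

(** Conjugation by [e] and [r] turns [b] into an endocell [b'] of [f], whose mate agrees with that
    of [b] up to isomorphism, so the case of endocells applies. *)
Lemma invertible_transpose_square (h : X ⟶ X) (k : A ⟶ A) (b : f ∘ h ⇒ k ∘ f)
    (e : h ≅ 𝟙 X) (r : k ≅ 𝟙 A) :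
  invertible b ->
  invertible (transpose M (runit k • (k ◁ eps) • assoc k f u • (b ▷ u) • bwd (assoc f h u))).
Proof.
move=> ib; set c := _ • _.
pose b' : f ⇒ f := lunit f • (r ▷ f) • b • (f ◁ bwd e) • bwd (runit f).
have cE : r • c • (f ◁ ((bwd e ▷ u) • bwd (lunit u))) = eps • (b' ▷ u).
  rewrite /c /b' !whiskerrM whiskerlM !compcA.
  rewrite (comp_eqA (esym (runit_nat r))) !compcA (comp_eqA (exchange _ _)) !compcA.
  rewrite (comp_eqA (esym (assoc_r _ _ r))) !compcA -lunit_id (comp_eqA (lunit_nat _)) !compcA.
  rewrite (comp_eqA (lunit_comp _ _)) (comp_eqA (bwd_nat (assoc_m _ _ (bwd e)))) !compcA.
  do 5! congr (_ • _).
  apply: (iso_monic (f := assoc f (𝟙 X) u)); rewrite fwdKA.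
  apply: (iso_monic (f := whiskerl_iso f (lunit u))) => /=.
  by rewrite (comp_eqA (triangle _ _)) -whiskerlM -whiskerrM !fwdK !comp2_id.
have ib' : invertible b'.
  apply: (invertible_comp (invertible_fwd _)).
  apply: (invertible_comp (invertible_whiskerr _ (invertible_fwd _))).
  apply: (invertible_comp ib).
  exact: (invertible_comp (invertible_whiskerl _ (invertible_bwd _)) (invertible_bwd _)).
have := invertible_transpose_endo ib'; rewrite -cE -compcA transpose_r transpose_l => i.
apply: (invertible_cancel_l (invertible_whiskerl u (invertible_fwd r))).
apply: invertible_cancel_r i; apply: invertible_comp; last exact: invertible_bwd.
exact/invertible_whiskerr/invertible_bwd.
Qed.

(** Composition with [f] is full on 2-cells. Transposing [f j k ≅ k] gives a section [s] of the
    counit at [k]; by fullness the endocell [s • counit] is [f ◁ b], and [b] is the identity because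
    it has the same transpose. *)
Lemma invertible_counit_of_equiv (j : A ⟶ X) (c : f ∘ j ≅ 𝟙 A) (e : j ∘ f ≅ 𝟙 X)
    Z (k : Z ⟶ A) :
  invertible (counit_at eps k).
Proof.
have jfaithful (x y : Z ⟶ A) (a b : x ⇒ y) : j ◁ a = j ◁ b -> a = b.
  move=> E; have [i iE] := invertible_iso (invertible_counit_at x (invertible_fwd c)).
  by apply: (iso_epic (f := i)); rewrite iE -!counit_at_nat E.
have ffull (x y : Z ⟶ X) (a : f ∘ x ⇒ f ∘ y) : exists b, f ◁ b = a.
  have [ix ixE] := invertible_iso (invertible_unit_at x (invertible_bwd e)).
  have [iy iyE] := invertible_iso (invertible_unit_at y (invertible_bwd e)).
  (* The preimage is [j ◁ a] conjugated by [j f ≅ 1]; since [j] is faithful on 2-cells, it suffices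
     to compare after [j]. *)
  exists (bwd iy • (j ◁ a) • ix); apply: jfaithful.
  by apply: (iso_epic (f := ix)); rewrite ixE -unit_at_nat -ixE -iyE fwdKA.
have [i iE] := invertible_iso (invertible_counit_at k (invertible_fwd c)).
pose s := (f ◁ transpose M i) • bwd i.
have es : counit_at eps k • s = idc k by rewrite /s -compcA transposeK fwdK.
have [b bE] := ffull _ _ (s • counit_at eps k).
have b1 : b = idc _.
  by apply: transpose_inj; rewrite bE -compcA es comp1c comp2_id compc1.
by split; apply: (IsIso (inv := s)) => //; rewrite -bE b1 comp2_id.
Qed.

Lemma invertible_counit :
  (forall Z (k : Z ⟶ A), invertible (counit_at eps k)) -> invertible eps.
Proof.
move=> /(_ _ (𝟙 A)) i; apply: invertible_id_whiskerr.
apply: (invertible_cancel_l (invertible_fwd (lunit _))).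
by apply: (invertible_cancel_r (invertible_bwd (assoc _ _ _))); rewrite compcA.
Qed.

End Transpose.

(** * Squares [q' T ⇒ S q] evaluated at generalized elements *)

Section Square.
Variables (P P' Y Y' : B) (q : P ⟶ Y) (q' : P' ⟶ Y').
Variables (S : Y ⟶ Y') (T : P ⟶ P') (s : q' ∘ T ⇒ S ∘ q).

Definition square_at Z (x : Z ⟶ P) : q' ∘ (T ∘ x) ⇒ S ∘ (q ∘ x) :=
  assoc S q x • (s ▷ x) • bwd (assoc q' T x).

Lemma square_at_nat Z (x x' : Z ⟶ P) (a : x ⇒ x') :
  square_at x' • (q' ◁ (T ◁ a)) = (S ◁ (q ◁ a)) • square_at x.
Proof.
rewrite /square_at !compcA (bwd_nat (assoc_l _ _ _)) (comp_eqA (exchange _ _)) !compcA.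
by rewrite (comp_eqA (assoc_l _ _ _)) compcA.
Qed.

Lemma square_at_comp Z W (x : Z ⟶ P) (z : W ⟶ Z) :
  square_at (x ∘ z) • (q' ◁ assoc T x z) • assoc q' (T ∘ x) z =
  (S ◁ assoc q x z) • assoc S (q ∘ x) z • (square_at x ▷ z).
Proof.
rewrite /square_at !whiskerrM -pentagonA !compcA (comp_eqA (assoc_r _ _ _)) !compcA.
do 2! congr (_ • _); apply: (iso_monic (f := assoc q' T (x ∘ z))).
by rewrite fwdKA pentagonA -whiskerrM fwdK comp2_id compc1.
Qed.

Lemma square_at_invertible Z (x : Z ⟶ P) : invertible s -> invertible (square_at x).
Proof.
move=> i; apply: invertible_comp; first exact: invertible_fwd.
by apply: invertible_comp; [apply: invertible_whiskerr | apply: invertible_bwd].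
Qed.

Lemma square_invertible : invertible (square_at (𝟙 P)) -> invertible s.
Proof.
move=> i; apply: invertible_id_whiskerr.
apply: (invertible_cancel_l (invertible_fwd (assoc S q (𝟙 P)))).
by apply: (invertible_cancel_r (invertible_bwd (assoc q' T (𝟙 P)))); rewrite compcA.
Qed.

End Square.

Lemma square_at_r P P' Y Y' (q : P ⟶ Y) (q' : P' ⟶ Y') (S : Y ⟶ Y') (T T' : P ⟶ P')
    (s : q' ∘ T' ⇒ S ∘ q) (t : T ⇒ T') Z (x : Z ⟶ P) :
  square_at (s • (q' ◁ t)) x = square_at s x • (q' ◁ (t ▷ x)).
Proof. by rewrite /square_at whiskerrM !compcA (bwd_nat (assoc_m _ _ _)). Qed.

Lemma square_at_l P P' Y Y' (q : P ⟶ Y) (q' : P' ⟶ Y') (S S' : Y ⟶ Y') (T : P ⟶ P')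
    (s : q' ∘ T ⇒ S ∘ q) (b : S ⇒ S') Z (x : Z ⟶ P) :
  square_at ((b ▷ q) • s) x = (b ▷ (q ∘ x)) • square_at s x.
Proof. by rewrite /square_at whiskerrM !compcA (comp_eqA (assoc_r _ _ _)) !compcA. Qed.

(** This is the shape that the Frobenius cell takes after projection. Pasting [r' ◁ b] with the
    inverse of [s] gives an invertible cell [c : f (r f) ⇒ (r' k) f] between [f] and itself along
    arrows isomorphic to identities, and the transpose in question is the mate of [c] up to an
    associator. *)
Lemma invertible_transpose_along_square X A W (f : X ⟶ A) (M : right_adjoint f)
    (r : A ⟶ X) (r' : W ⟶ A) (g k : A ⟶ W) (s : r' ∘ g ⇒ f ∘ r) (b : g ∘ f ⇒ k ∘ f)
    (e : r ∘ f ≅ 𝟙 X) (e' : r' ∘ k ≅ 𝟙 A)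
    (i : r' ∘ (g ∘ (f ∘ radj M)) ≅ f ∘ (r ∘ (f ∘ radj M))) :
  invertible s -> invertible b -> fwd i = square_at s (f ∘ radj M) ->
  invertible (transpose M ((r' ◁ (runit k • (k ◁ adj_counit M) • assoc k f (radj M)
    • (b ▷ radj M) • bwd (assoc g f (radj M)))) • bwd i)).
Proof.
set u := radj M => hs ib iE.
have [j jE] := invertible_iso (square_at_invertible f hs).
pose c := bwd (assoc r' k f) • (r' ◁ b) • bwd j.
have ic : invertible c.
  apply: (invertible_comp (invertible_bwd _)).
  exact: (invertible_comp (invertible_whiskerl _ ib) (invertible_bwd _)).
have cE : c • j = bwd (assoc r' k f) • (r' ◁ b) by rewrite /c !compcA bwdK compc1.
have := invertible_transpose_square M e e' ic; move: (c) cE => {ic}c cE ic.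
set t := (X in invertible X); suff -> : t = transpose M
  (runit (r' ∘ k) • (r' ∘ k ◁ adj_counit M) • assoc (r' ∘ k) f u • (c ▷ u)
      • bwd (assoc f (r ∘ f) u)) • bwd (assoc r f u).
  exact: (invertible_comp ic (invertible_bwd _)).
rewrite /t -transpose_r; congr transpose.
apply: (iso_epic (f := i)); apply: (iso_epic (f := whiskerl_iso r' (assoc g f u))) => /=.
apply: (iso_epic (f := assoc r' (g ∘ f) u)).
rewrite !compcA bwdKA iE square_at_comp -jE.
rewrite (comp_eqA (whiskerl_iso_l f (assoc r f u))) comp1c bwdKA -whiskerrM cE whiskerrM.
rewrite !(whiskerlM r') !compcA (comp_eqA (whiskerl_iso_l r' (assoc g f u))) comp1c -assoc_m.
rewrite -runit_comp !compcA (comp_eqA (assoc_l _ _ _)) !compcA pentagonA.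
by rewrite (comp_eqA (whiskerr_iso_r u (assoc r' k f))) comp1c.
Qed.

(** * Cells into [q'^* S q] and the squares that they transpose to *)

Section Projected.
Variables (P P' Y Y' : B) (q : P ⟶ Y) (q' : P' ⟶ Y') (M : right_adjoint q').
Variables (S : Y ⟶ Y') (T : P ⟶ P') (pi : T ⇒ radj M ∘ (S ∘ q)).

(* The cells [pi] of interest are the two local projections of [R ⊠ S]. *)
Definition pi_at Z (x : Z ⟶ P) : T ∘ x ⇒ radj M ∘ (S ∘ (q ∘ x)) :=
  (radj M ◁ assoc S q x) • assoc (radj M) (S ∘ q) x • (pi ▷ x).

Definition untranspose : q' ∘ T ⇒ S ∘ q := counit_at (adj_counit M) (S ∘ q) • (q' ◁ pi).

Lemma untranspose_invertible : invertible (adj_counit M) -> invertible pi -> invertible untranspose.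
Proof.
by move=> i j; apply: invertible_comp; [apply: invertible_counit_at | apply: invertible_whiskerl].
Qed.

Lemma untranspose_atE Z (x : Z ⟶ P) :
  square_at untranspose x = counit_at (adj_counit M) (S ∘ (q ∘ x)) • (q' ◁ pi_at x).
Proof.
rewrite /square_at /pi_at (whiskerlM q' (_ ◁ _)) (comp_eqA (counit_at_nat _ _)).
rewrite [in RHS]compcA.
congr (_ • _); rewrite /untranspose whiskerrM -counit_at_comp whiskerlM !compcA.
by rewrite (comp_eqA (assoc_m _ _ _)) !compcA fwdK compc1.
Qed.

End Projected.

Lemma untranspose_r P P' Y Y' (q : P ⟶ Y) (q' : P' ⟶ Y') (M : right_adjoint q')
    (S : Y ⟶ Y') (T T' : P ⟶ P') (pi : T' ⇒ radj M ∘ (S ∘ q)) (t : T ⇒ T') :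
  untranspose (pi • t) = untranspose pi • (q' ◁ t).
Proof. by rewrite /untranspose whiskerlM !compcA. Qed.

Section ProjectedComp.
Variables (P P' P'' Y Y' Y'' : B) (q : P ⟶ Y) (q' : P' ⟶ Y') (q'' : P'' ⟶ Y'').
Variables (M' : right_adjoint q') (M'' : right_adjoint q'').
Variables (S : Y ⟶ Y') (S' : Y' ⟶ Y'') (T : P ⟶ P') (T' : P' ⟶ P'').
Variables (pi : T ⇒ radj M' ∘ (S ∘ q)) (pi' : T' ⇒ radj M'' ∘ (S' ∘ q')).

Lemma pi_at_cancel_mid Z (x : Z ⟶ P) :
  (radj M'' ◁ assoc S' S (q ∘ x))
    • pi_at (cancel_mid (radj M'') S' M' S q • (pi' ⋆ pi)) x =
  (radj M'' ◁ (S' ◁ square_at (untranspose pi) x)) • pi_at pi' (T ∘ x) • assoc T' T x.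
Proof.
rewrite /square_at /untranspose /pi_at /cancel_mid.
(* Both sides contain the same counit cell, one inside [cancel_mid] and one inside [untranspose].
   Once it is generalized, only naturality and pentagons remain. *)
move: (counit_at _ _) => c; rewrite !whiskerlM !whiskerrM !compcA.
do 3! rewrite ?(comp_eqA (assoc_m _ _ _)) ?compcA.
have e1 w (y : w ⇒ _) : (radj M'' ◁ assoc S' S (q ∘ x)) • (radj M'' ◁ assoc (S' ∘ S) q x)
      • (radj M'' ◁ (bwd (assoc S' S q) ▷ x)) • y =
    (radj M'' ◁ (S' ◁ assoc S q x)) • (radj M'' ◁ assoc S' (S ∘ q) x) • y.
  rewrite -!compcA -!whiskerlM; congr ((_ ◁ _) • _).
  by rewrite pentagon !compcA -whiskerrM fwdK comp2_id compc1.
rewrite {}e1; congr (_ • _).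
rewrite (comp_eqA (esym (whiskerlM (radj M'') _ _))) assoc_m whiskerlM compcA.
rewrite [in RHS](whiskerlM S') whiskerlM compcA; congr (_ • _).
set K := radj M' ∘ (S ∘ q).
have e2 w (y : w ⇒ _) : (radj M'' ◁ assoc S' (q' ∘ K) x)
      • (radj M'' ◁ (assoc S' q' K ▷ x)) • y =
    (radj M'' ◁ (S' ◁ bwd (assoc q' K x))) • (radj M'' ◁ assoc S' q' (K ∘ x))
      • (radj M'' ◁ assoc (S' ∘ q') K x) • y.
  rewrite -!compcA -!whiskerlM; congr ((_ ◁ _) • _).
  by rewrite compcA pentagon -compcA -whiskerlM bwdK comp2_id comp1c.
rewrite {}e2 -pentagonA assoc_nat -(whisker_lr pi' (pi ▷ x)) !compcA.
rewrite (comp_eqA (assoc_l _ _ _)) compcA.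
rewrite (comp_eqA (esym (whiskerlM (radj M'') (assoc _ _ _) _))) assoc_l whiskerlM compcA.
rewrite !(comp_eqA (esym (whiskerlM (radj M'') (S' ◁ _) (S' ◁ _)))) -!(whiskerlM S').
by rewrite (bwd_nat (assoc_m _ _ _)).
Qed.

(** [cancel_mid] is built so that, under transposition along [q''], it becomes the pasting of the
    two squares. *)
Lemma untranspose_cancel_mid Z (x : Z ⟶ P) :
  assoc S' S (q ∘ x)
    • square_at (untranspose (cancel_mid (radj M'') S' M' S q • (pi' ⋆ pi))) x =
  (S' ◁ square_at (untranspose pi) x) • square_at (untranspose pi') (T ∘ x)
    • (q'' ◁ assoc T' T x).
Proof.
rewrite !untranspose_atE (comp_eqA (esym (counit_at_nat _ _))) compcA -whiskerlM pi_at_cancel_mid whiskerlM.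
by rewrite (comp_eqA (counit_at_nat _ _)) whiskerlM untranspose_atE !compcA.
Qed.

End ProjectedComp.

(** Maps form a locally full subbicategory, so the inverse of a cell there is its inverse in [B]. *)
Definition map_iso X Y (f g : map_cat X Y) (i : f ≅ g) : proj1_sig f ≅ proj1_sig g :=
  @Iso (X ⟶ Y) _ _ (fwd i) (@IsIso (X ⟶ Y) _ _ (fwd i) (bwd i) (bwdK i) (fwdK i)).

End Bicategory.

(** * Isomorphisms given by the universal properties of finite products *)

Section ProductIsos.
Variables (C : bicategory) (FP : finite_products C).
Implicit Types X Y Z : C.
Local Notation I := (trm (fp_term FP)).
Local Notation pp X Y := (pp FP X Y).
Local Notation rr X Y := (rr FP X Y).

Definition trm_iso Z (x y : Z ⟶ I) : x ≅ y :=
  reflect_iso (trm_universal (fp_term FP) Z)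
    (id_iso (C := unit_cat) tt : to_unit_cat _ x ≅ to_unit_cat _ y).

Definition prod_iso Z X Y (x y : Z ⟶ prodo FP X Y)
    (a : pp X Y ∘ x ≅ pp X Y ∘ y) (b : rr X Y ∘ x ≅ rr X Y ∘ y) : x ≅ y :=
  let F := cone_functor (pp X Y) (rr X Y) Z in
  reflect_iso (prd_universal (fp_prod FP X Y) Z) (pair_iso (F x) (F y) a b).

Definition to_trm Z : Z ⟶ I := lift_ob (trm_universal (fp_term FP) Z) tt.

Definition unit_pair_l X : X ⟶ prodo FP I X := pair1 FP (to_trm X) (𝟙 X).
Definition unit_pair_r X : X ⟶ prodo FP X I := pair1 FP (𝟙 X) (to_trm X).

(** Together with [pair_r], this makes the projection [rr I X] an equivalence with quasi-inverse
    [unit_pair_l X]. *)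
Definition unit_pair_lK X : unit_pair_l X ∘ rr I X ≅ 𝟙 (prodo FP I X) :=
  prod_iso (trm_iso _ _)
    (comp_iso (inv_iso (runit _)) (comp_iso (lunit _) (pair_r_comp FP _ _ _))).

Definition unit_pair_rK X : unit_pair_r X ∘ pp X I ≅ 𝟙 (prodo FP X I) :=
  prod_iso (comp_iso (inv_iso (runit _)) (comp_iso (lunit _) (pair_p_comp FP _ _ _)))
    (trm_iso _ _).

(** In elements, [(x, y)] goes to [((x, x), y)], then to [(x, (x, y))], and dropping the first
    coordinate gives [(x, y)] back. *)
Definition rr_assoc_diag X :
    rr X (prodo FP X X) ∘ (assoc_map FP X X X ∘ times FP (diag FP X) (𝟙 X))
    ≅ 𝟙 (prodo FP X X) :=
  let t := times FP (diag FP X) (𝟙 X) in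
  comp_iso
    (prod_iso
      (comp_iso (inv_iso (runit _)) (comp_iso (lunit _)
        (comp_iso (whiskerr_iso _ (pair_r FP _ _)) (comp_iso (inv_iso (assoc _ _ _))
          (comp_iso (whiskerl_iso _ (pair_p FP _ _)) (comp_iso (assoc _ _ _)
            (pair_p_comp FP (rr X X ∘ pp _ X) (rr _ X) t)))))))
      (comp_iso (inv_iso (runit _)) (comp_iso (lunit _)
        (comp_iso (pair_r FP _ _) (pair_r_comp FP (rr X X ∘ pp _ X) (rr _ X) t)))))
    (pair_r_comp FP (pp X X ∘ pp _ X) (pair1 FP (rr X X ∘ pp _ X) (rr _ X)) t).

End ProductIsos.

(** * The squares induced by the local projections of a tensor product *)

Section Cartesian.
Variables (B : bicategory) (ra : adjoint_choice B) (K : cartesian ra).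
Hypothesis maps_comonadic :
  forall (X A : B) (g : @hom1 (Map B) X A), comonadic ra g.

Let MP := map_products K.
Let LP := local_products K.
Let I : B := trm (fp_term MP).
Implicit Types X Y A : B.
Local Notation "X ⊗ Y" := (tensor_ob MP X Y) (at level 39, no associativity).
Local Notation "R ⊠ S" := (tensor ra MP LP R S) (at level 39, no associativity).

Definition tensor_p_square X Y A A' (R : X ⟶ A) (S : Y ⟶ A') :
    pt MP A A' ∘ (R ⊠ S) ⇒ R ∘ pt MP X Y :=
  untranspose (M := pt_adj ra MP A A') (tensor_p ra MP LP R S).

Definition tensor_r_square X Y A A' (R : X ⟶ A) (S : Y ⟶ A') :
    rt MP A A' ∘ (R ⊠ S) ⇒ S ∘ rt MP X Y :=
  untranspose (M := rt_adj ra MP A A') (tensor_r ra MP LP R S).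

Lemma tensor_p_square_comp X Y A1 A2 C1 C2 (R' : A1 ⟶ C1) (S' : A2 ⟶ C2)
    (R : X ⟶ A1) (S : Y ⟶ A2) Z (x : Z ⟶ X ⊗ Y) :
  assoc R' R (pt MP X Y ∘ x) • square_at (tensor_p_square (R' ∘ R) (S' ∘ S)) x
    • (pt MP C1 C2 ◁ (tensor_comp ra MP LP R' S' R S ▷ x)) =
  (R' ◁ square_at (tensor_p_square R S) x)
    • square_at (tensor_p_square R' S') ((R ⊠ S) ∘ x)
    • (pt MP C1 C2 ◁ assoc (R' ⊠ S') (R ⊠ S) x).
Proof.
by rewrite -untranspose_cancel_mid -square_at_r -untranspose_r /tensor_p fst_pairc.
Qed.

Lemma tensor_r_square_comp X Y A1 A2 C1 C2 (R' : A1 ⟶ C1) (S' : A2 ⟶ C2)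
    (R : X ⟶ A1) (S : Y ⟶ A2) Z (x : Z ⟶ X ⊗ Y) :
  assoc S' S (rt MP X Y ∘ x) • square_at (tensor_r_square (R' ∘ R) (S' ∘ S)) x
    • (rt MP C1 C2 ◁ (tensor_comp ra MP LP R' S' R S ▷ x)) =
  (S' ◁ square_at (tensor_r_square R S) x)
    • square_at (tensor_r_square R' S') ((R ⊠ S) ∘ x)
    • (rt MP C1 C2 ◁ assoc (R' ⊠ S') (R ⊠ S) x).
Proof.
by rewrite -untranspose_cancel_mid -square_at_r -untranspose_r /tensor_r snd_pairc.
Qed.

Lemma tensor_r_square_id X Y Z (x : Z ⟶ X ⊗ Y) :
  square_at (tensor_r_square (𝟙 X) (𝟙 Y)) x
    • (rt MP X Y ◁ (tensor_id ra MP LP X Y ▷ x)) • (rt MP X Y ◁ bwd (lunit x)) =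
  bwd (lunit (rt MP X Y ∘ x)).
Proof.
rewrite (comp_eqA (esym (square_at_r _ _ _))) -untranspose_r /tensor_r snd_pairc.
(* The projected [tensor_id] is essentially the unit of [r ⊣ r^*], so a triangle identity reduces
   its transpose to unit constraints. *)
have -> : untranspose ((radj (rt_adj ra MP X Y) ◁ bwd (lunit (rt MP X Y)))
      • adj_unit (rt_adj ra MP X Y)) = bwd (lunit (rt MP X Y)) • runit (rt MP X Y).
  rewrite /untranspose whiskerlM (comp_eqA (counit_at_nat _ _)) compcA; congr (_ • _).
  apply: (iso_epic (f := inv_iso (runit (rt MP X Y)))); rewrite fwdK.
  by rewrite -[RHS](adj_triangle_l (rt_adj ra MP X Y)) /counit_at !compcA.
rewrite /square_at whiskerrM !compcA (comp_eqA (lunit_compV _ _)) -[RHS]compc1.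
congr (_ • _); rewrite -triangle !compcA fwdKA.
by rewrite -whiskerlM fwdK comp2_id.
Qed.

Lemma tensor_r_square_tensor2 X Y A A' (R R' : X ⟶ A) (S S' : Y ⟶ A')
    (a : R ⇒ R') (b : S ⇒ S') Z (x : Z ⟶ X ⊗ Y) :
  square_at (tensor_r_square R' S') x
    • (rt MP A A' ◁ (tensor2 ra MP LP a b ▷ x)) =
  (b ▷ (rt MP X Y ∘ x)) • square_at (tensor_r_square R S) x.
Proof.
rewrite -square_at_r -square_at_l; congr (square_at _ x).
rewrite /tensor_r_square -untranspose_r /tensor_r snd_pairc /untranspose.
by rewrite whiskerlM (comp_eqA (counit_at_nat _ _)) compcA.
Qed.

(** As [I] is a pseudofunctor, the identity of [I] is isomorphic to the top arrow; its terminality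
    passes to every map into [I]. *)
Lemma terminal_map X (f : X ⟶ I) : is_map f -> terminal f.
Proof.
move=> [F]; apply: (map_terminal F).
exact: terminal_of_iso_top (unit_id_iso K).
Qed.

Lemma is_map_arr X Y (f : X ⟶ₘ Y) : is_map (arr f).
Proof. exact: proj2_sig f. Qed.

(** Both factors of the transpose are invertible: the counit because [r : I ⊗ Y' → Y'] is an
    equivalence, and the local projection because the other factor of the meet is terminal. *)
Lemma tensor_r_square_unit X Y Y' (R : X ⟶ I) (S : Y ⟶ Y') :
  is_map R -> invertible (tensor_r_square R S).
Proof.
move=> mR; apply: untranspose_invertible.
  apply: invertible_counit.
  exact: (invertible_counit_of_equiv (rt_adj ra MP I Y')
    (map_iso (pair_r MP (to_trm MP Y') (@id1 (Map B) Y'))) (map_iso (unit_pair_lK MP Y'))).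
apply: invertible_sndc; apply: terminal_radj; apply: terminal_map.
by case: mR => F; apply: (is_map_comp (pt_adj ra MP X Y) F).
Qed.

Lemma tensor_p_square_unit X X' Y (R : X ⟶ X') (S : Y ⟶ I) :
  is_map S -> invertible (tensor_p_square R S).
Proof.
move=> mS; apply: untranspose_invertible.
  apply: invertible_counit.
  exact: (invertible_counit_of_equiv (pt_adj ra MP X' I)
    (map_iso (pair_p MP (@id1 (Map B) X') (to_trm MP X'))) (map_iso (unit_pair_rK MP X'))).
apply: invertible_fstc; apply: terminal_radj; apply: terminal_map.
by case: mS => F; apply: (is_map_comp (rt_adj ra MP X Y) F).
Qed.

(* Two out of three, comparing with the composite [(t ⊗ 1) (1 ⊗ S)] for [t : X → I]. *)
Lemma tensor_r_square_id_l X Y Y' (S : Y ⟶ Y') : invertible (tensor_r_square (𝟙 X) S).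
Proof.
pose t : X ⟶ I := arr (to_trm MP X); have mt : is_map t := is_map_arr (to_trm MP X).
(* Invertibility is tested at the identity of [X ⊗ Y] and after whiskering with [𝟙 Y'], which is how
   the square occurs in [E]. *)
apply: square_invertible; apply: invertible_id_whiskerl.
have := tensor_r_square_comp t (𝟙 Y') (𝟙 X) S (𝟙 (X ⊗ Y)).
set c := square_at (tensor_r_square (t ∘ 𝟙 X) _) _; set c' := square_at _ (_ ∘ _) => E.
have ic : invertible c.
  apply: square_at_invertible; apply: tensor_r_square_unit.
  by case: mt => F; apply: (is_map_comp (id_adjoint X) F).
have ic' : invertible c' by apply: square_at_invertible; apply: tensor_r_square_unit.
apply: (invertible_cancel_eq (esym E)).
  apply: (invertible_comp (invertible_fwd _) (invertible_comp ic _)).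
  by apply/invertible_whiskerl/invertible_whiskerr; split; apply: tensor_comp_iso.
exact: (invertible_comp ic' (invertible_whiskerl _ (invertible_fwd _))).
Qed.

(** The mirror image, through the composite [(1 ⊗ t) (R ⊗ 1)] for [t : Y → I]. *)
Lemma tensor_p_square_id_r X X' Y (R : X ⟶ X') : invertible (tensor_p_square R (𝟙 Y)).
Proof.
pose t : Y ⟶ I := arr (to_trm MP Y); have mt : is_map t := is_map_arr (to_trm MP Y).
apply: square_invertible; apply: invertible_id_whiskerl.
have := tensor_p_square_comp (𝟙 X') t R (𝟙 Y) (𝟙 (X ⊗ Y)).
set c := square_at (tensor_p_square _ (t ∘ 𝟙 Y)) _; set c' := square_at _ (_ ∘ _) => E.
have ic : invertible c.
  apply: square_at_invertible; apply: tensor_p_square_unit.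
  by case: mt => F; apply: (is_map_comp (id_adjoint Y) F).
have ic' : invertible c' by apply: square_at_invertible; apply: tensor_p_square_unit.
apply: (invertible_cancel_eq (esym E)).
  apply: (invertible_comp (invertible_fwd _) (invertible_comp ic _)).
  by apply/invertible_whiskerl/invertible_whiskerr; split; apply: tensor_comp_iso.
exact: (invertible_comp ic' (invertible_whiskerl _ (invertible_fwd _))).
Qed.

(** Whiskered with [r] and followed by the invertible square of [1 ⊠ g], the comparison becomes the
    product isomorphism [pair_r]; being comonadic, [r] reflects invertibility. *)
Lemma invertible_times_tensor_id_l X Y Y' (g : Y ⟶ₘ Y') :
  invertible (times_tensor K (@id1 (Map B) X) g).
Proof.
apply: (comonadic_conservative (maps_comonadic (rr MP X Y'))).
apply: (invertible_cancel_l (tensor_r_square_id_l X (arr g))).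
rewrite /tensor_r_square -untranspose_r /tensor_r snd_pairc /untranspose transposeK.
exact: (invertible_fwd (map_iso (pair_r MP (@id1 (Map B) X ∘ pp MP X Y) (g ∘ rr MP X Y)))).
Qed.

Lemma invertible_times_tensor_id_r X X' Y (f : X ⟶ₘ X') :
  invertible (times_tensor K f (@id1 (Map B) Y)).
Proof.
apply: (comonadic_conservative (maps_comonadic (pp MP X' Y))).
apply: (invertible_cancel_l (tensor_p_square_id_r Y (arr f))).
rewrite /tensor_p_square -untranspose_r /tensor_p fst_pairc /untranspose transposeK.
exact: (invertible_fwd (map_iso (pair_p MP (f ∘ pp MP X Y) (@id1 (Map B) Y ∘ rr MP X Y)))).
Qed.

(** Projection by [r] sends the unit of [f ⊗ g ⊣ f^* ⊗ g^*] to that of [g ⊣ g^*], because the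
    squares respect composition, 2-cells and identities. *)
Lemma tensor_r_square_tensor_unit X Y A A' (f : X ⟶ A) (F : right_adjoint f)
    (g : Y ⟶ A') (G : right_adjoint g) Z (x : Z ⟶ X ⊗ Y) :
  (radj G ◁ square_at (tensor_r_square f g) x)
    • square_at (tensor_r_square (radj F) (radj G)) ((f ⊠ g) ∘ x)
    • (rt MP X Y ◁ unit_at (tensor_unit K F G) x) =
  unit_at (adj_unit G) (rt MP X Y ∘ x).
Proof.
have E := tensor_r_square_comp (radj F) (radj G) f g x.
have E2 := tensor_r_square_tensor2 (adj_unit F) (adj_unit G) x.
have E3 := tensor_r_square_id x.
(* This equation determines [tensor_unit] without naming the inverse of [tensor_comp]; the unit is
   generalized below and used through it alone. *)
have eK : tensor_comp ra MP LP (radj F) (radj G) f g • tensor_unit K F G =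
    tensor2 ra MP LP (adj_unit F) (adj_unit G) • tensor_id ra MP LP X Y.
  by rewrite /tensor_unit (comp_eqA (inv_r _)) comp1c.
move: (square_at (tensor_r_square f g) x) (square_at (tensor_r_square (radj F) _) _) E => s1 s2.
move: (square_at (tensor_r_square (_ ∘ f) _) x) E2 => s E2.
move: (square_at _ x) E2 E3 (tensor_unit K F G) eK => s3 E2 E3 eta eK E.
rewrite !unit_atE (whiskerlM (rt MP X Y) (assoc _ _ _)) -E3.
rewrite -[LHS]compcA -[LHS]compcA (compcA _ s2) -E !compcA; congr (_ • _).
rewrite whiskerlM (comp_eqA (esym (whiskerlM _ _ _))) -whiskerrM eK whiskerrM whiskerlM !compcA.
by rewrite (comp_eqA E2) compcA.
Qed.

(** * The coassociativity cell and the Frobenius cell of an object *)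

Section Frobenius.
Variable A : B.
Let d : A ⟶ A ⊗ A := arr (diag MP A).
Let d_adj : right_adjoint d := ra (diag MP A).
Let a : (A ⊗ A) ⊗ A ⟶ A ⊗ (A ⊗ A) := arr (assoc_map MP A A A).
Let r : A ⊗ A ⟶ A := rt MP A A.
Let r' : A ⊗ (A ⊗ A) ⟶ A ⊗ A := rt MP A (A ⊗ A).
Let u : A ⊗ A ⟶ A := radj d_adj.

Lemma rt_diag : inhabited (r ∘ d ≅ 𝟙 A).
Proof. by split; apply: (map_iso (pair_r MP (@id1 (Map B) A) (@id1 (Map B) A))). Qed.

(** This is [rr_assoc_diag] with [d × 1] replaced by the isomorphic [d ⊠ 1]; it is only [inhabited],
    since invertibility of the comparison is a [Prop]. *)
Lemma rt_assoc_diag : inhabited (r' ∘ (a ∘ (d ⊠ 𝟙 A)) ≅ 𝟙 (A ⊗ A)).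
Proof.
have [i _] := invertible_iso (invertible_times_tensor_id_r A (diag MP A)).
split; apply: (comp_iso (map_iso (rr_assoc_diag MP A))).
exact/whiskerl_iso/whiskerl_iso/inv_iso.
Qed.

Lemma frobenius_mate_invertible (theta : (𝟙 A ⊠ d) ∘ d ⇒ a ∘ ((d ⊠ 𝟙 A) ∘ d)) :
  invertible theta -> invertible (frobenius_mate theta).
Proof.
move=> itheta; apply: (comonadic_conservative (maps_comonadic (rr MP A A))).
rewrite -/(rt MP A A) -/r.
have isg : invertible (tensor_r_square (𝟙 A) d) by apply: tensor_r_square_id_l.
set k := a ∘ (d ⊠ 𝟙 A).
have isv := square_at_invertible k (tensor_r_square_id_l A u).
(* The goal becomes the projected mate followed by [r (1 ⊠ u) k ≅ u (r' k)]; this composite is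
   identified below with a transpose along [d]. *)
apply: (invertible_cancel_l isv).
have [e] := rt_diag; have [e'] := rt_assoc_diag.
have [i iE] := invertible_iso (square_at_invertible (d ∘ u) isg).
have := invertible_transpose_along_square e e' isg
  (invertible_comp (invertible_bwd (assoc a (d ⊠ 𝟙 A) d)) itheta) iE.
set tau := (X in r' ◁ X).
have -> : frobenius_mate theta =
    (𝟙 A ⊠ u ◁ tau) • unit_at (tensor_unit K (id_adjoint A) d_adj) (d ∘ u) by [].
(* This turns the unit of [1 ⊗ d] into the unit of [d], at the cost of the isomorphism [i];
   naturality of the square of [1 ⊠ u] moves [tau] past it. *)
have := tensor_r_square_tensor_unit (id_adjoint A) d_adj (d ∘ u).
have := square_at_nat (tensor_r_square (𝟙 A) u) tau.
rewrite /= -iE -/u -/r -/r'.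
move=> nat_tau E; rewrite /transpose -E.
have ei : (u ◁ ((r' ◁ tau) • bwd i)) • (u ◁ i) = u ◁ (r' ◁ tau).
  by rewrite -whiskerlM compcA bwdK compc1.
by rewrite (comp_eqA ei) (whiskerlM r (𝟙 A ⊠ u ◁ tau)) (comp_eqA nat_tau) compcA.
Qed.

Lemma frobenius_all : frobenius K A.
Proof.
have itl := invertible_times_tensor_id_l A (diag MP A).
have itr := invertible_times_tensor_id_r A (diag MP A).
have [i iE] := invertible_iso (invertible_whiskerr d itl).
pose w : arr (times MP (@id1 (Map B) A) (diag MP A)) ∘ d
    ⇒ a ∘ (arr (times MP (diag MP A) (@id1 (Map B) A)) ∘ d) := diag_coassoc MP A.
have iw : invertible w by exact: (invertible_fwd (map_iso (diag_coassoc MP A))).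
(* [theta] is the equation of [is_coassoc] solved for its unknown; uniqueness follows by cancelling
   the invertible [i]. *)
pose theta := (a ◁ (times_tensor K (diag MP A) (@id1 (Map B) A) ▷ d)) • w • bwd i.
exists theta.
have itheta : invertible theta.
  apply: invertible_comp; first exact/invertible_whiskerl/invertible_whiskerr.
  exact: (invertible_comp iw (invertible_bwd i)).
split; last exact: frobenius_mate_invertible.
have thetaE : theta • i = (a ◁ (times_tensor K (diag MP A) (@id1 (Map B) A) ▷ d)) • w.
  by rewrite /theta !compcA bwdK compc1.
split; first by split=> //; rewrite -[X in _ • X]iE thetaE.
by move=> theta' [_ tE]; apply: (iso_epic (f := i)); rewrite thetaE iE tE.
Qed.

End Frobenius.

End Cartesian.

Theorem proposition2p3 (B : bicategory) (B_normal : normal B)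
    (ra : adjoint_choice B) (K : cartesian ra)
    (maps_comonadic : forall (X A : B) (g : @hom1 (Map B) X A), comonadic ra g) :
  forall A : B, frobenius K A.
Proof. by move=> A; apply: frobenius_all. Qed.
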